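(* Let $A$ be a unital $C^*$-algebra and let $\psi\in\mathrm{SS}(A)$ be a symmetric state on $\mathfrak A=\ast_1^\infty A$. Let $\rho$ denote the restriction of $\hat\psi$ to the tail $C^*$-algebra $D_\psi$. Then $$\psi=\rho\circ F_\psi\circ\pi_\psi.$$ Moreover, (i) if $\rho$ is a pure state of $D_\psi$, then $\psi$ is an extreme point of $\mathrm{SS}(A)$; (ii) if $\psi$ is an extreme point of $\mathrm{SS}(A)$ and if $D_\psi\subseteq\pi_\psi(\mathfrak A)$, then $\rho$ is a pure state of $D_\psi$.
   Context: $\mathfrak A=\ast_{i=1}^\infty A$ is the universal unital free product $C^*$-algebra of infinitely many copies of $A$, with canonical embeddings $\lambda_i:A\to\mathfrak A$. A state $\psi$ on $\mathfrak A$ is symmetric if $\psi(\lambda_{i(1)}(a_1)\cdots\lambda_{i(n)}(a_n))=\psi(\lambda_{\sigma(i(1))}(a_1)\cdots\lambda_{\sigma(i(n))}(a_n))$ for all $n$, $i(j)\in\mathbf N$, $a_j\in A$ and all permutations $\sigma$ of $\mathbf N$; $\mathrm{SS}(A)$ is the (weak$^*$-compact, convex) set of symmetric states. For symmetric $\psi$: $\pi_\psi$ is the GNS representation on $L^2(\mathfrak A,\psi)$ with cyclic vector $\hat1$; $\pi_i=\pi_\psi\circ\lambda_i$; $\mathcal M_\psi=\pi_\psi(\mathfrak A)''$; $\hat\psi=\langle\,\cdot\,\hat1,\hat1\rangle$ on $\mathcal M_\psi$; $\mathcal T_\psi=\bigcap_{N\ge1}W^*(\bigcup_{i\ge N}\pi_i(A))$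 is the tail algebra; $\mathcal Q_\psi$ is the $C^*$-subalgebra of $\mathcal M_\psi$ generated by $\mathcal T_\psi\cup\pi_\psi(\mathfrak A)$; $\alpha$ is the unique $*$-endomorphism of $\mathcal Q_\psi$ with $\alpha\circ\pi_i=\pi_{i+1}$ for all $i$ and $\alpha|_{\mathcal T_\psi}=\mathrm{id}$; $F_\psi:\mathcal Q_\psi\to\mathcal T_\psi$ is the conditional expectation $F_\psi(x)=\mathrm{WOT}\text{-}\lim_{n\to\infty}\alpha^n(x)$. The tail $C^*$-algebra $D_\psi$ is the smallest unital $C^*$-subalgebra of $\mathcal T_\psi$ such that $F_\psi(\pi_{i_1}(a_1)x_1\cdots\pi_{i_{n-1}}(a_{n-1})x_{n-1}\pi_{i_n}(a_n))\in D_\psi$ for all $n\in\mathbf N$, $x_1,\dots,x_{n-1}\in D_\psi$, $a_1,\dots,a_n\in A$ and $i_1,\dots,i_n\in\mathbf N$; in particular $F_\psi$ maps $\pi_\psi(\mathfrak A)$ into $D_\psi$. *)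

(* Defs.v *)
From HB Require Import structures.
From mathcomp Require Import all_boot all_order all_algebra.
From mathcomp Require Import complex.
From mathcomp Require Import all_classical all_reals all_analysis.
Set Implicit Arguments.
Unset Strict Implicit.
Unset Printing Implicit Defensive.
Import Order.TTheory GRing.Theory Num.Theory.
Import numFieldNormedType.Exports.
Local Open Scope classical_set_scope.
Local Open Scope ring_scope.
Local Open Scope complex_scope.

(* Unital C*-algebras over R[i].  The norm is a field of its own because
   Hierarchy Builder admits no structure below both the ring and the normed
   module hierarchies other than the numeric domains.  [GRing.Algebra] forces
   1 != 0; the zero algebra, thus excluded, has no state. *)
HB.mixin Record isCStarAlgebra (R : realType) A of GRing.Algebra R[i] A := {
  star : A -> A;
  cnorm : A -> R;
  starK : involutive star;
  star_linear : forall (c : R[i]) (x y : A),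
    star (c *: x + y) = Num.conj c *: star x + star y;
  starM : forall x y : A, star (x * y) = star y * star x;
  cnorm0_eq0 : forall x : A, cnorm x = 0 -> x = 0;
  cnormD : forall x y : A, cnorm (x + y) <= cnorm x + cnorm y;
  cnormZ : forall (c : R[i]) (x : A),
    (cnorm (c *: x))%:C = `|c| * (cnorm x)%:C;
  cnormM : forall x y : A, cnorm (x * y) <= cnorm x * cnorm y;
  cnorm_star : forall x : A, cnorm (star x * x) = cnorm x ^+ 2;
  cnorm_complete : forall u : nat -> A,
    (forall e : R, 0 < e -> exists N : nat, forall m n : nat,
       (N <= m)%N -> (N <= n)%N -> cnorm (u m - u n) < e) ->
    exists l : A, (fun n => cnorm (u n - l)) @ \oo --> (0 : R) }.

#[short(type="cstarAlgType")]
HB.structure Definition CStarAlgebra (R : realType) :=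
  {A of isCStarAlgebra R A & GRing.Algebra R[i] A}.

(* The inner product is linear in its first argument. *)
HB.mixin Record isHilbert (R : realType) H of CompleteNormedModule R[i] H := {
  inner : H -> H -> R[i];
  inner_linear : forall (c : R[i]) (x y z : H),
    inner (c *: x + y) z = c * inner x z + inner y z;
  innerC : forall x y : H, inner y x = Num.conj (inner x y);
  inner_norm : forall x : H, inner x x = `|x| ^+ 2 }.

#[short(type="hilbertType")]
HB.structure Definition Hilbert (R : realType) :=
  {H of isHilbert R H & CompleteNormedModule R[i] H}.

Definition extreme_point (R : realType) (T : Type) (K : set (T -> R[i]))
    (f : T -> R[i]) : Prop :=
  K f /\ forall (g h : T -> R[i]) (t : R), K g -> K h -> 0 < t < 1 ->
    (forall x, f x = t%:C * g x + (1 - t)%:C * h x) -> g = f /\ h = f.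

Section CStar.
Variable R : realType.
Implicit Types A B : cstarAlgType R.

Definition star_preserving A B (f : A -> B) : Prop :=
  forall x, f (star x) = star (f x).

Definition cstar_subalgebra A (S : set A) : Prop :=
  [/\ S 1,
      (forall (c : R[i]) x y, S x -> S y -> S (c *: x + y)),
      (forall x y, S x -> S y -> S (x * y)),
      (forall x, S x -> S (star x)) &
      (forall x, (forall e : R, 0 < e -> exists2 y, S y & cnorm (x - y) < e) ->
         S x)].

Definition state A (f : A -> R[i]) : Prop :=
  [/\ scalar f, (forall x, 0 <= f (star x * x)) & f 1 = 1].

(* The universal unital free product of countably many copies of A: it is
   generated by the lam i, which makes the homomorphism Phi below unique. *)
Definition universal_free_product A (U : cstarAlgType R)
    (lam : nat -> {lrmorphism A -> U}) : Prop :=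
  [/\ (forall i, star_preserving (lam i)),
      (forall S : set U, cstar_subalgebra S -> (forall i a, S (lam i a)) ->
         S = setT) &
      (forall (B : cstarAlgType R) (phi : nat -> {lrmorphism A -> B}),
         (forall i, star_preserving (phi i)) ->
         exists2 Phi : {lrmorphism U -> B},
           star_preserving Phi & forall i a, Phi (lam i a) = phi i a)].

Definition symmetric_states A (U : cstarAlgType R)
    (lam : nat -> {lrmorphism A -> U}) : set (U -> R[i]) :=
  [set psi | state psi /\
     forall (w : seq (nat * A)) (sigma : nat -> nat), bijective sigma ->
       psi (\prod_(p <- w) lam p.1 p.2) =
       psi (\prod_(p <- w) lam (sigma p.1) p.2)].

End CStar.

(* B(H) is handled as the set [bounded_op] of functions H -> H, with pointwise
   linear structure, composition as product and [idfun] as unit. *)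
Section Operators.
Variables (R : realType) (H : hilbertType R).
Implicit Types (S X : set (H -> H)) (T : H -> H).

Definition bounded_op : set (H -> H) :=
  [set T | linear T /\ continuous T].

Definition adjoint_op T T' : Prop :=
  forall x y, inner (T x) y = inner x (T' y).

Definition star_closed S : Prop :=
  forall T T', S T -> bounded_op T' -> adjoint_op T T' -> S T'.

Definition commutant S : set (H -> H) :=
  [set T | bounded_op T /\ forall T', S T' -> T \o T' = T' \o T].

Definition von_neumann_algebra S : Prop :=
  [/\ S `<=` bounded_op, star_closed S & commutant (commutant S) = S].

Definition vn_generated X : set (H -> H) :=
  [set T | forall S, von_neumann_algebra S -> X `<=` S -> S T].

(* Unital C*-subalgebras of B(H); the last clause is closedness in operator
   norm. *)
Definition op_cstar_algebra S : Prop :=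
  [/\ S `<=` bounded_op,
      S idfun,
      (forall (c : R[i]) T T', S T -> S T' -> S (fun x => c *: T x + T' x)),
      (forall T T', S T -> S T' -> S (T \o T')) /\ star_closed S &
      (forall T, bounded_op T ->
         (forall e : R[i], 0 < e ->
            exists2 T', S T' & forall x, `|T x - T' x| <= e * `|x|) ->
         S T)].

Definition op_cstar_generated X : set (H -> H) :=
  [set T | forall S, op_cstar_algebra S -> X `<=` S -> S T].

(* Functionals on S are functions on the subtype of S, so that two of them are
   equal as soon as they agree on S. *)
Definition op_state S : set (S -> R[i]) :=
  [set f | [/\ (forall (c : R[i]) (T1 T2 T : S),
                  val T = (fun x => c *: val T1 x + val T2 x) ->
                  f T = c * f T1 + f T2),
               (forall T1 T2 T : S, adjoint_op (val T1) (val T2) ->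
                  val T = val T2 \o val T1 -> 0 <= f T) &
               (forall T : S, val T = idfun -> f T = 1)]].

Definition pure_state S (f : S -> R[i]) : Prop := extreme_point (@op_state S) f.

Definition vector_functional (xi : H) S : S -> R[i] :=
  fun T : S => inner (val T xi) xi.

Definition star_endomorphism S (alpha : (H -> H) -> (H -> H)) : Prop :=
  [/\ (forall T, S T -> S (alpha T)),
      (forall (c : R[i]) T T', S T -> S T' ->
         alpha (fun x => c *: T x + T' x) =
         (fun x => c *: alpha T x + alpha T' x)),
      (forall T T', S T -> S T' -> alpha (T \o T') = alpha T \o alpha T') &
      (forall T T', S T -> S T' -> adjoint_op T T' ->
         adjoint_op (alpha T) (alpha T'))].

Definition wot_cvg (u : nat -> H -> H) T : Prop :=
  forall x y,
    (fun n => inner (u n x) y : R[i]^o) @ \oo --> (inner (T x) y : R[i]^o).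

End Operators.

Section Tail.
Variables (R : realType) (A U : cstarAlgType R) (H : hilbertType R).
Variables (lam : nat -> {lrmorphism A -> U}) (pi : U -> H -> H).
Implicit Types (alpha F : (H -> H) -> (H -> H)) (S : set (H -> H)).

(* (H, pi, xi) is a GNS triple of psi; it is unique up to unitary
   equivalence. *)
Definition gns (psi : U -> R[i]) (xi : H) : Prop :=
  [/\ (forall a, bounded_op (pi a)) /\ pi 1 = idfun,
      (forall (c : R[i]) a b, pi (c *: a + b) = (fun x => c *: pi a x + pi b x)),
      (forall a b, pi (a * b) = pi a \o pi b) /\
      (forall a, adjoint_op (pi a) (pi (star a))),
      closure (range (fun a => pi a xi)) = setT &
      (forall a, psi a = inner (pi a xi) xi)].

Definition tail_algebra : set (H -> H) :=
  \bigcap_N vn_generated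
    [set T | exists i a, (N <= i)%N /\ T = pi (lam i a)].

Definition tail_Q : set (H -> H) :=
  op_cstar_generated (tail_algebra `|` range pi).

(* alpha and F are total functions whose values outside tail_Q are irrelevant;
   the predicates below determine them on tail_Q. *)
Definition tail_shift alpha : Prop :=
  [/\ star_endomorphism tail_Q alpha,
      (forall i a, alpha (pi (lam i a)) = pi (lam i.+1 a)) &
      (forall T, tail_algebra T -> alpha T = T)].

Definition tail_expectation alpha F : Prop :=
  forall T, tail_Q T ->
    tail_algebra (F T) /\ wot_cvg (fun n => iter n alpha T) (F T).

(* pi_(i_1)(a_1) x_1 ... pi_(i_(n-1))(a_(n-1)) x_(n-1) pi_(i_n)(a_n), where w
   lists the triples ((i_k, a_k), x_k) for k < n. *)
Definition tail_word (w : seq ((nat * A) * (H -> H))) (i : nat) (a : A) :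
    H -> H :=
  foldr (fun p T => pi (lam p.1.1 p.1.2) \o p.2 \o T) (pi (lam i a)) w.

Definition tail_word_closed F S : Prop :=
  forall (w : seq ((nat * A) * S)) (i : nat) (a : A),
    S (F (tail_word [seq (p.1, val p.2) | p <- w] i a)).

Definition tail_cstar_algebra F : set (H -> H) :=
  [set T | forall S, op_cstar_algebra S -> S `<=` tail_algebra ->
     tail_word_closed F S -> S T].

End Tail.

(* Main.v *)
Require Import Defs.
From HB Require Import structures.
From mathcomp Require Import all_boot all_order all_algebra.
From mathcomp Require Import complex.
From mathcomp Require Import all_classical all_reals all_analysis.
From mathcomp Require Import ring lra zify.
Import Order.TTheory GRing.Theory Num.Theory.
Import numFieldNormedType.Exports.
Local Open Scope classical_set_scope.
Local Open Scope ring_scope.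
Local Open Scope complex_scope.

Set Implicit Arguments.
Unset Strict Implicit.
Unset Printing Implicit Defensive.

(** The expectation [F] is the weak limit of the iterates of the shift [alpha],
    and a symmetric state does not see the shift.  So a symmetric functional of
    the form [a |-> inner (pi a xi) eta] takes the same value at every
    [alpha ^ n (pi a)] and hence at the limit [F (pi a)]
    ([expectation_symmetric_functional]).  For [eta = xi] this is the formula
    [psi = rho o F o pi].

    If [psi = t g + (1 - t) h] with [g] and [h] symmetric, then [t g <= psi], and
    the Riesz representation ([Riesz_dense], [bounded_form_operator]) yields a
    positive operator [T] in the commutant of [pi] with
    [g a = inner (pi a xi) (T xi)].  Since [T] commutes with the tail algebra,
    [d |-> inner (d xi) (T xi)] is a state of [D], and [rho] is the convex
    combination of the two states that arise from [g] and [h].  When [rho] is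
    pure they equal [rho], and the formula above, for [eta = T xi], gives
    [g = rho o F o pi = psi].

    Conversely let [rho = t g + (1 - t) h] with states [g] and [h] of [D].  Then
    [g o F o pi] and [h o F o pi] are symmetric states of which [psi] is a convex
    combination, so that both equal [psi] when [psi] is extreme; if [D] is
    contained in the range of [pi], every [d] in [D] is [F (pi a)] for some [a],
    whence [g = h = rho].  Symmetry holds because [F (pi w)] depends on a word [w]
    only up to a permutation of its indices ([expectation_word_reindex]): between
    fixed vectors, far shifts of [w] may be permuted without touching the rest.
    Positivity holds because a state of an operator algebra that is dominated by
    a vector functional is nonnegative at every positive operator of the algebra
    ([dominated_op_state_ge0]).

    No continuity is assumed of [alpha] or of [pi].  It follows from the
    bound [f (star y * y) <= cnorm y ^ 2 * f 1] for positive functionals, which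
    rests on the square roots in [one_sub_is_square]. *)

(** * Limits and order of complex scalars *)

Section Scalars.
Variable R : realType.
Implicit Types (c e : R[i]).

Lemma conj_realC (s : R) : Num.conj s%:C = s%:C.
Proof. by apply/conj_Creal; rewrite complex_real. Qed.

Lemma conjc_ge0 c : 0 <= c -> Num.conj c = c.
Proof. by move=> c0; apply/conj_Creal/ger0_real. Qed.

Lemma le0_of_leM_eps (a k : R) : (forall e : R, 0 < e -> a <= k * e) -> a <= 0.
Proof.
move=> h; apply/ler_addgt0Pl => e e0; rewrite addr0.
have k0 : 0 < `|k| + 1 by rewrite ltr_wpDl.
apply: le_trans (h (e / (`|k| + 1)) _) _; first by rewrite divr_gt0.
rewrite mulrCA ger_pMr // ler_pdivrMr // mul1r.
by apply: le_trans (ler_norm k) _; rewrite lerDl.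
Qed.

Lemma eq0_of_normrM_eps (V : normedZmodType R[i]) (u : V) c :
  0 <= c -> (forall e, 0 < e -> `|u| <= c * e) -> u = 0.
Proof.
move=> c0 h; apply/eqP; rewrite -normr_eq0; apply/eqP/le_anti.
rewrite normr_ge0 andbT; apply/negbNE/negP => u0.
have {}u0 : 0 < `|u| by rewrite lt_def normr_ge0 andbT; apply: contra u0 => /eqP ->.
have c1 : 0 < c + 1 by rewrite ltr_wpDl.
have := h (`|u| / (c + 1)) (divr_gt0 u0 c1).
rewrite mulrCA -subr_ge0 -[X in _ - X]mulr1 -mulrBr pmulr_rge0 // => hc.
have : c / (c + 1) < 1 by rewrite ltr_pdivrMr // mul1r ltrDl.
by rewrite -subr_lt0 => /lt_geF; rewrite hc.
Qed.

Lemma complex_ge0_closed c :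
  (forall e, 0 < e -> exists2 p : R[i], 0 <= p & `|c - p| <= e) -> 0 <= c.
Proof.
move=> h.
have hre (r : R) : 0 < r -> - r <= complex.Re c /\ `|complex.Im c| <= r.
  move=> r0; have [|p p0 hp] := h r%:C; first by rewrite ltcR.
  have pre : p = (complex.Re p)%:C by rewrite RRe_real // ger0_real.
  have pr0 : 0 <= complex.Re p by rewrite -lecR -pre.
  have hR := le_trans (normc_ge_Re _) hp.
  have hI : `|complex.Im (c - p)|%:C <= r%:C.
    rewrite -normrN -ReiNIm; apply: le_trans (normc_ge_Re _) _.
    by rewrite normrM [X in _ * X]normc_def /= expr0n add0r expr1n sqrtr1 mulr1.
  move: hR hI; rewrite !lecR pre !raddfB /= subr0 => hR hI; split=> //.
  by move: hR; rewrite ler_norml => /andP[hR _]; apply: le_trans hR _; rewrite gerBl.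
have im0 : complex.Im c = 0.
  apply/eqP; rewrite -normr_eq0; apply/eqP/le_anti; rewrite normr_ge0 andbT.
  by apply/ler_addgt0Pl => e /hre [_]; rewrite addr0.
rewrite lecE im0 eqxx /= -[X in X <= _]opprK lerNl oppr0.
by apply/ler_addgt0Pl => e /hre [he _]; rewrite addr0 lerNl.
Qed.

End Scalars.

(** * Positive sesquilinear forms *)

Definition positive_form {C : numClosedFieldType} {V : lmodType C}
    (B : V -> V -> C) : Prop :=
  [/\ (forall c x y z, B (c *: x + y) z = c * B x z + B y z),
      (forall c x y z, B z (c *: x + y) = Num.conj c * B z x + B z y) &
      (forall x, 0 <= B x x)].

Section PositiveForm.
Variables (C : numClosedFieldType) (V : lmodType C) (B : V -> V -> C).
Hypothesis hB : positive_form B.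

(** Polarization: the values of the form at [x + y] and ['i *: x + y] are
    real. *)
Lemma positive_form_hermitian x y : B y x = Num.conj (B x y).
Proof.
have [Bl Br Bp] := hB.
have real_conj z : Num.conj (B z z) = B z z by apply/conj_Creal/ger0_real.
have key (c : C) : Num.conj c * Num.conj (B y x) + c * Num.conj (B x y)
    = Num.conj c * B x y + c * B y x.
  have e : B (c *: y + x) (c *: y + x) =
      c * Num.conj c * B y y + B x x + (Num.conj c * B x y + c * B y x).
    by rewrite Bl !Br; ring.
  have := real_conj (c *: y + x); rewrite e !rmorphD !rmorphM /= conjCK.
  rewrite !real_conj [Num.conj c * c]mulrC => /addrI.
  by rewrite addrC.
have k1 := key 1; have ki := key 'i%R.
rewrite rmorph1 !mul1r in k1; rewrite conjCi in ki.
have {}ki : Num.conj (B x y) - Num.conj (B y x) = B y x - B x y.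
  apply: (@mulfI _ 'i%R); first exact: neq0Ci.
  by rewrite !mulrBr; move: ki; rewrite !mulNr addrC => ->; rewrite addrC.
have h2 : 2 * Num.conj (B x y) = 2 * B y x.
  set p := Num.conj (B x y) in k1 ki *; set q := Num.conj (B y x) in k1 ki.
  have -> : 2 * p = (q + p) + (p - q) by ring.
  by rewrite k1 ki; ring.
by apply/esym/(mulfI _ h2); rewrite pnatr_eq0.
Qed.

(** The form may be degenerate, so that [B x x] and [B y y] may both vanish; then
    [B] is [- 2 * `|B x y| ^ 2] at [x - B x y *: y]. *)
Lemma positive_form_CauchySchwarz x y : `|B x y| ^+ 2 <= B x x * B y y.
Proof.
have [Bl Br Bp] := hB.
have herm := positive_form_hermitian.
have B_comb (c d : C) u v :
    B (c *: u + d *: v) (c *: u + d *: v) =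
    c * Num.conj c * B u u + d * Num.conj d * B v v
    + (c * Num.conj d * B u v + d * Num.conj c * B v u).
  have Zl e w z : B (e *: w) z = e * B w z.
    have B0z : B 0 z = 0.
      have := Bl 1 0 0 z; rewrite scaler0 addr0 mul1r => /esym/eqP.
      by rewrite -[X in _ == X]add0r (inj_eq (@addIr _ _)) => /eqP.
    by rewrite -[e *: w]addr0 Bl B0z addr0.
  have Zr e w z : B z (e *: w) = Num.conj e * B z w.
    by rewrite herm Zl rmorphM /= -herm.
  by rewrite Bl !Br !Zl !Zr; ring.
have sqB u v : `|B u v| ^+ 2 = B u v * B v u by rewrite normCK -herm.
(* the vector [B v v *: u - B u v *: v] is [B v v] times the component of [u]
   orthogonal to [v] *)
have pos u v : 0 < B v v -> `|B u v| ^+ 2 <= B u u * B v v.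
  move=> v0; have vr : Num.conj (B v v) = B v v by apply/conj_Creal/gtr0_real.
  have := Bp (B v v *: u + (- B u v) *: v).
  rewrite B_comb !rmorphN /= vr -[Num.conj (B u v)]herm.
  have -> : B v v * B v v * B u u + - B u v * - B v u * B v v +
      (B v v * - B v u * B u v + - B u v * B v v * B v u)
      = B v v * (B u u * B v v - B u v * B v u) by ring.
  by rewrite pmulr_rge0 // subr_ge0 sqB.
have := Bp y; rewrite le0r => /orP[/eqP y0|]; last exact: pos.
have := Bp x; rewrite le0r => /orP[/eqP x0|x0]; last first.
  by have := pos y x x0; rewrite herm norm_conjC mulrC.
have := Bp (1 *: x + (- B x y) *: y).
rewrite B_comb x0 y0 !mulr0 !add0r rmorph1 rmorphN /= -herm mul1r mulr1.
have -> : - B y x * B x y + - B x y * B y x = - (2 * (B x y * B y x)) by ring.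
by rewrite oppr_ge0 pmulr_rle0 ?ltr0n // -sqB.
Qed.

End PositiveForm.

(** * Positive functionals on C*-algebras *)

Section CStarAlgebras.
Variables (R : realType) (A : cstarAlgType R).
Implicit Types (x y z : A) (f : A -> R[i]).

Lemma star0 : star (0 : A) = 0.
Proof.
have := star_linear 1 (0 : A) 0.
rewrite rmorph1 !scale1r addr0 => /esym/eqP.
by rewrite -[X in _ == X]addr0 (inj_eq (@addrI _ _)) => /eqP.
Qed.

Lemma starZ c x : star (c *: x) = Num.conj c *: star x.
Proof. by rewrite -[c *: x]addr0 star_linear star0 addr0. Qed.

Lemma starD x y : star (x + y) = star x + star y.
Proof. by rewrite -[x]scale1r star_linear rmorph1 !scale1r. Qed.

Lemma starN x : star (- x) = - star x.
Proof. by rewrite -scaleN1r starZ rmorphN rmorph1 scaleN1r. Qed.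

Lemma star1 : star (1 : A) = 1.
Proof. by rewrite -[RHS]starK -[in RHS](mul1r (star 1)) starM !starK mul1r. Qed.

Lemma cnormZr (c : R) x : cnorm (c%:C *: x) = `|c| * cnorm x.
Proof.
apply: complexI; rewrite cnormZ rmorphM; congr (_ * _).
by rewrite normc_def /= expr0n addr0 sqrtr_sqr.
Qed.

Lemma cnorm0 : cnorm (0 : A) = 0.
Proof.
rewrite -(scale0r 0) -[0 in X in X *: _](rmorph0 (real_complex R)).
by rewrite cnormZr normr0 mul0r.
Qed.

Lemma cnormN x : cnorm (- x) = cnorm x.
Proof. by apply: complexI; rewrite -scaleN1r cnormZ normrN1 mul1r. Qed.

Lemma cnorm_ge0 x : 0 <= cnorm x.
Proof.
by have := cnormD x (- x); rewrite subrr cnorm0 cnormN -mulr2n pmulrn_lge0.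
Qed.

Lemma cnormC x y : cnorm (x - y) = cnorm (y - x).
Proof. by rewrite -cnormN opprB. Qed.

Lemma cnorm_starE x : cnorm (star x) = cnorm x.
Proof.
have le y : cnorm y <= cnorm (star y).
  have := cnormM (star y) y; rewrite cnorm_star expr2.
  have := cnorm_ge0 y; rewrite le0r => /orP[/eqP -> _|y0]; first exact: cnorm_ge0.
  by rewrite ler_pM2r.
by apply/eqP; rewrite eq_le le -{2}(starK x) le.
Qed.

(** The square root is [1 - w], where [w] is the fixed point of the contraction
    [w |-> (x + w ^ 2) / 2] of the ball of radius [cnorm x]. *)
Lemma one_sub_is_square x : star x = x -> cnorm x < 1 ->
  exists z, 1 - x = star z * z.
Proof.
move=> xs x1; set r := cnorm x in x1.
have r0 : 0 <= r := cnorm_ge0 x.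
pose step w : A := (2^-1)%:C *: (x + w * w).
pose W n := iter n step 0.
have half y : cnorm ((2^-1)%:C *: y) = cnorm y / 2.
  by rewrite cnormZr ger0_norm ?invr_ge0 // mulrC.
have Wr n : cnorm (W n) <= r.
  elim: n => [|n IH]; first by rewrite cnorm0.
  rewrite /= half ler_pdivrMr //; apply: le_trans (cnormD _ _) _.
  rewrite -/r mulr_natr mulr2n lerD2l; apply: le_trans (cnormM _ _) _.
  by apply: le_trans (ler_pM (cnorm_ge0 _) (cnorm_ge0 _) IH IH) _;
    rewrite ler_piMr // ltW.
have sq_diff y z : cnorm (step y - step z) <=
    cnorm (y - z) * ((cnorm y + cnorm z) / 2).
  rewrite -scalerBr half opprD addrACA subrr add0r mulrA ler_pM2r ?invr_gt0 //.
  have -> : y * y - z * z = (y - z) * y + z * (y - z).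
    by rewrite mulrBl mulrBr addrA subrK.
  apply: le_trans (cnormD _ _) _.
  rewrite [leRHS]mulrDr; apply: lerD; first exact: cnormM.
  by rewrite [leRHS]mulrC; exact: cnormM.
have Wdiff k n : cnorm (W (n + k)%N - W n) <= r ^+ n.
  elim: n => [|n IH].
    by rewrite add0n subr0 expr0; apply: le_trans (Wr k) (ltW x1).
  apply: le_trans (sq_diff _ _) _; rewrite exprSr.
  apply: ler_pM IH _; rewrite ?cnorm_ge0 //.
    by rewrite divr_ge0 // addr_ge0 ?cnorm_ge0.
  by rewrite ler_pdivrMr // mulr_natr mulr2n lerD ?Wr.
have rn0 (e : R) : 0 < e -> exists N, forall n, (N <= n)%N -> r ^+ n < e.
  move=> e0; have : (fun n => r ^+ n) @ \oo --> (0 : R).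
    by apply: cvg_expr; rewrite ger0_norm.
  move=> /cvgrPdist_lt/(_ e e0) [N _ hN]; exists N => n /hN.
  by rewrite /= sub0r normrN ger0_norm // exprn_ge0.
have [|l hl] := cnorm_complete W.
  move=> e e0; have [N hN] := rn0 _ e0; exists N.
  have hlt m n : (N <= n)%N -> (n <= m)%N -> cnorm (W m - W n) < e.
    move=> Nn nm; rewrite -(subnKC nm); apply: le_lt_trans (Wdiff _ _) _.
    exact: hN.
  move=> m n Nm Nn; have [nm|/ltnW mn] := leqP n m; first exact: hlt.
  by rewrite cnormC; exact: hlt.
have near_l (e : R) : 0 < e ->
    exists n, cnorm (W n - l) <= e /\ cnorm (W n.+1 - l) <= e.
  move=> e0; move/cvgrPdist_le: hl => /(_ e e0) [N _ hN]; exists N.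
  have h n : (N <= n)%N -> cnorm (W n - l) <= e.
    by move=> /hN /=; rewrite sub0r normrN ger0_norm // cnorm_ge0.
  by split; apply: h; rewrite ?leqnSn.
have Ws n : star (W n) = W n.
  elim: n => [|n IH]; first exact: star0.
  rewrite [LHS]starZ starD starM /= IH xs; congr (_ *: _).
  exact: conj_realC.
have ls : star l = l.
  apply/eqP; rewrite -subr_eq0; apply/eqP/cnorm0_eq0/le_anti.
  rewrite cnorm_ge0 andbT; apply: (@le0_of_leM_eps _ _ 2) => e /near_l [n [he _]].
  rewrite -(subrKA (W n)); apply: le_trans (cnormD _ _) _.
  rewrite mulrC mulr_natr mulr2n; apply: lerD; last exact: he.
  by rewrite -[X in _ - X]Ws -starN -starD cnorm_starE cnormC.
have lfix : l = step l.
  apply/eqP; rewrite -subr_eq0; apply/eqP/cnorm0_eq0/le_anti.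
  rewrite cnorm_ge0 andbT.
  apply: (@le0_of_leM_eps _ _ (1 + (r + cnorm l) / 2)) => e /near_l [n [he he1]].
  rewrite -(subrKA (W n.+1)); apply: le_trans (cnormD _ _) _.
  rewrite mulrDl mul1r; apply: lerD; first by rewrite cnormC.
  apply: le_trans (sq_diff _ _) _; rewrite mulrC.
  apply: ler_pM => //; rewrite ?cnorm_ge0 ?divr_ge0 ?addr_ge0 ?cnorm_ge0 //.
  by rewrite ler_pM2r ?invr_gt0 // lerD2r.
exists (1 - l); rewrite starD starN star1 ls mulrBl mul1r mulrBr mulr1.
have hl2 : l + l = x + l * l.
  rewrite {1 2}lfix -scalerDl -rmorphD /= -mulr2n -[_ *+ 2]mulr_natr.
  by rewrite mulVf ?pnatr_eq0 // scale1r.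
by rewrite -(addrK (l * l) x) -hl2 !opprB opprD !addrA [1 + l * l - l]addrAC.
Qed.

(** Bounded through the positivity of [f (1 - star w * w)] for
    [w = y / sqrt s], where [s > cnorm y ^+ 2]. *)
Lemma positive_functional_bound f y :
  scalar f -> (forall x, 0 <= f (star x * x)) ->
  f (star y * y) <= (cnorm y ^+ 2)%:C * f 1.
Proof.
move=> flin fpos.
have f1pos : 0 <= f 1 by have := fpos 1; rewrite star1 mulr1.
have key (e : R) : 0 < e -> f (star y * y) <= (cnorm y ^+ 2 + e)%:C * f 1.
  move=> e0; set s := cnorm y ^+ 2 + e.
  have s0 : 0 < s by rewrite ltr_wpDl // sqr_ge0.
  have [||z hz] := @one_sub_is_square ((s^-1)%:C *: (star y * y)).
  - by rewrite starZ starM starK conj_realC.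
  - rewrite cnormZr cnorm_star ger0_norm ?invr_ge0 ?ltW // mulrC ltr_pdivrMr //.
    by rewrite mul1r ltrDl.
  have := fpos z; rewrite -hz (zmod_morphism_linear flin) (scalable_linear flin).
  rewrite subr_ge0 rmorphV /=; last by rewrite unitfE gt_eqF.
  by rewrite mulrC ler_pdivrMr ?ltcR // mulrC.
have re (z : R[i]) : 0 <= z -> z = (complex.Re z)%:C.
  by move=> z0; rewrite RRe_real // ger0_real.
have {}key (e : R) : 0 < e ->
    complex.Re (f (star y * y)) - cnorm y ^+ 2 * complex.Re (f 1)
    <= complex.Re (f 1) * e.
  move/key; rewrite {1}(re _ (fpos y)) {1}(re _ f1pos) -rmorphM /= lecR mulrDl.
  by rewrite [e * _]mulrC lerBlDl.
rewrite {1}(re _ (fpos y)) {1}(re _ f1pos) -rmorphM /= lecR -subr_le0.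
exact: (le0_of_leM_eps key).
Qed.

End CStarAlgebras.

(** * Hilbert spaces *)

Section HilbertSpaces.
Variables (R : realType) (H : hilbertType R).
Implicit Types (x y z h k : H) (T : H -> H) (c e : R[i]).

Lemma inner_linear_r c x y z :
  inner z (c *: x + y) = Num.conj c * inner z x + inner z y.
Proof. by rewrite innerC inner_linear rmorphD rmorphM /= -!innerC. Qed.

Lemma inner_positive_form : positive_form (@inner R H).
Proof.
split; [exact: inner_linear | exact: inner_linear_r |].
by move=> x; rewrite inner_norm exprn_ge0.
Qed.

Lemma innerBl x y z : inner (x - y) z = inner x z - inner y z.
Proof. by rewrite addrC -scaleN1r inner_linear mulN1r addrC. Qed.

Lemma innerBr x y z : inner z (x - y) = inner z x - inner z y.
Proof. by rewrite innerC innerBl rmorphB /= -!innerC. Qed.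

Lemma inner0l x : inner 0 x = 0.
Proof. by rewrite -(subrr x) innerBl subrr. Qed.

Lemma innerDl x y z : inner (x + y) z = inner x z + inner y z.
Proof. by rewrite -[x]scale1r inner_linear mul1r scale1r. Qed.

Lemma innerDr x y z : inner z (x + y) = inner z x + inner z y.
Proof. by rewrite innerC innerDl rmorphD /= -!innerC. Qed.

Lemma innerZl c x y : inner (c *: x) y = c * inner x y.
Proof. by rewrite -[c *: x]addr0 inner_linear inner0l addr0. Qed.

Lemma innerZr c x y : inner y (c *: x) = Num.conj c * inner y x.
Proof. by rewrite innerC innerZl rmorphM /= -innerC. Qed.

Lemma inner_CauchySchwarz x y : `|inner x y| <= `|x| * `|y|.
Proof.
have := positive_form_CauchySchwarz inner_positive_form x y.
by rewrite !inner_norm -exprMn ler_pXn2r // nnegrE // mulr_ge0.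
Qed.

Lemma bounded_op_bound T :
  bounded_op T -> exists2 c, 0 < c & forall x, `|T x| <= c * `|x|.
Proof.
move=> [Tlin Tcont].
pose TL : {linear H -> H} := HB.pack T (GRing.isLinear.Build _ _ _ _ T Tlin).
have := (linear_bounded_continuous TL).2 Tcont.
move=> /linear_boundedP /pinfty_ex_gt0 [c c0 hc].
by exists c.
Qed.

Lemma bound_bounded_op T c :
  linear T -> 0 <= c -> (forall x, `|T x| <= c * `|x|) -> bounded_op T.
Proof.
move=> Tlin c0 hc; split=> //.
pose TL : {linear H -> H} := HB.pack T (GRing.isLinear.Build _ _ _ _ T Tlin).
apply: (linear_bounded_continuous TL).1; apply/linear_boundedP.
near=> r => x /=; apply: le_trans (hc x) _; apply: ler_wpM2r => //.
by near: r; apply: nbhs_pinfty_ge; exact: ger0_real.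
Unshelve. all: by end_near.
Qed.

Lemma bounded_op_comp T T' : bounded_op T -> bounded_op T' -> bounded_op (T \o T').
Proof.
move=> [Tlin Tc] [T'lin T'c]; split.
  by move=> c x y /=; rewrite T'lin Tlin.
by move=> x; apply: continuous_comp; [exact: T'c | exact: Tc].
Qed.

Lemma bounded_op_id : bounded_op (@idfun H).
Proof.
by apply: (@bound_bounded_op _ 1) => // x; rewrite mul1r.
Qed.

Lemma bounded_op_comb c T T' : bounded_op T -> bounded_op T' ->
  bounded_op (fun x => c *: T x + T' x).
Proof.
move=> hT hT'; have [d d0 hd] := bounded_op_bound hT.
have [d' d'0 hd'] := bounded_op_bound hT'.
apply: (@bound_bounded_op _ (`|c| * d + d')).
- move=> b x y; rewrite hT.1 hT'.1 !scalerDr !scalerA [c * b]mulrC.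
  by rewrite addrACA.
- by rewrite addr_ge0 ?mulr_ge0 // ltW.
- move=> x; apply: le_trans (ler_normD _ _) _; rewrite mulrDl lerD //.
  by rewrite normrZ -mulrA ler_wpM2l.
Qed.

Lemma inner_ext x y : (forall z, inner z x = inner z y) -> x = y.
Proof.
move=> h; apply/eqP; rewrite -subr_eq0 -normr_eq0.
have := inner_norm (x - y); rewrite innerBr h subrr => /esym/eqP.
by rewrite expf_eq0.
Qed.

End HilbertSpaces.

(** * Bounded forms on a dense subspace *)

Section DenseRange.
Variables (R : realType) (H : hilbertType R) (V : lmodType R[i]) (j : V -> H).
Hypothesis jlin : linear j.
Hypothesis jdense : closure (range j) = setT.

Lemma dense_approx h (e : R[i]) : 0 < e -> exists v, `|h - j v| < e.
Proof.
move=> e0; have : closure (range j) h by rewrite jdense.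
move=> /(_ (ball h e) (nbhsx_ballx h e e0)) [_ [[v _ <-]]].
by rewrite -ball_normE /=; exists v.
Qed.

Lemma dense_inner_ext x y : (forall v, inner (j v) x = inner (j v) y) -> x = y.
Proof.
move=> h; apply/eqP; rewrite -subr_eq0; apply/eqP; set d := x - y.
apply: (@eq0_of_normrM_eps _ _ _ 1) => // e e0; rewrite mul1r.
have [v hv] := dense_approx d e0.
have e1 : inner (d - j v) d = `|d| ^+ 2.
  by rewrite innerBl [X in _ - X]innerBr h subrr subr0 inner_norm.
have := inner_CauchySchwarz (d - j v) d; rewrite e1 normrX normr_id.
have [->|d0] := eqVneq d 0; first by rewrite normr0 => _; exact: ltW.
rewrite expr2 ler_pM2r ?normr_gt0 // => /le_trans; apply; exact: ltW.
Qed.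

Let re_inner (h k : H) : R := complex.Re (inner h k).

Let normR (h : H) : R := complex.Re `|h|.

Let normRE h : `|h| = (normR h)%:C.
Proof. exact/esym/RRe_real/ger0_real/normr_ge0. Qed.

Let normR_ge0 h : 0 <= normR h.
Proof. by rewrite -lecR -normRE normr_ge0. Qed.

Let re_norm (z : R[i]) (r : R) : `|z| <= r%:C -> `|complex.Re z| <= r.
Proof. by move=> h; rewrite -lecR; apply: le_trans (normc_ge_Re _) h. Qed.

Let re_innerxx h : re_inner h h = normR h ^+ 2.
Proof. by rewrite /re_inner inner_norm normRE -rmorphXn. Qed.

Let re_innerC h k : re_inner h k = re_inner k h.
Proof. by rewrite /re_inner innerC; case: (inner k h). Qed.

(** The density of the range of [j] allows one to test with [y] itself. *)
Lemma dense_norm_le y (c : R) : 0 <= c ->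
  (forall v, `|inner (j v) y| <= c%:C * `|j v|) -> `|y| <= c%:C.
Proof.
move=> c0 h; rewrite normRE lecR; set n := normR y.
have key : n ^+ 2 - c * n <= 0.
  apply: (@le0_of_leM_eps _ _ (n + c)) => e e0.
  have [|v] := @dense_approx y e%:C; first by rewrite ltcR.
  rewrite normRE ltcR => hv.
  have hjv : normR (j v) <= n + e.
    rewrite -lecR rmorphD /= -!normRE -[j v](subrK y) addrC.
    apply: le_trans (ler_normD _ _) _; rewrite lerD2l distrC normRE lecR.
    exact: ltW.
  have h1 : `|re_inner (j v) y| <= c * normR (j v).
    by apply: re_norm; rewrite rmorphM /= -normRE.
  have h2 : `|re_inner (y - j v) y| <= normR (y - j v) * n.
    by apply: re_norm; rewrite rmorphM /= -!normRE; exact: inner_CauchySchwarz.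
  have -> : n ^+ 2 = re_inner (j v) y + re_inner (y - j v) y.
    by rewrite /n -re_innerxx /re_inner innerBl raddfB addrC subrK.
  have := ler_norm (re_inner (j v) y); have := ler_norm (re_inner (y - j v) y).
  have := normR_ge0 y; rewrite -/n; nra.
have [n0|n0] := ltrP 0 n; last exact: le_trans n0 c0.
by rewrite -(ler_pM2r n0) -subr_le0 -expr2.
Qed.

(** Riesz representation.  The representing vector is the limit of a minimizing
    sequence of [v |-> `|j v| ^ 2 - 2 Re (f v)], which the parallelogram
    identity makes Cauchy; at the limit the derivative along each [w] vanishes,
    which says that [f w] and [inner (j w) y] have the same real part. *)
Lemma Riesz_dense (f : V -> R[i]) (c : R) :
  0 <= c -> scalar f -> (forall v, `|f v| <= c%:C * `|j v|) ->
  exists2 y, forall v, f v = inner (j v) y & `|y| <= c%:C.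
Proof.
move=> c0 flin fbd.
have fD : {morph f : x y / x + y}.
  by move=> x y; rewrite -[x in LHS]scale1r flin mul1r.
have fZ := scalable_linear flin.
have jD : {morph j : x y / x + y}.
  by move=> x y; rewrite -[x in LHS]scale1r jlin scale1r.
have jZ := scalable_linear jlin.
have ReZ (s : R) (z : R[i]) : complex.Re (s%:C * z) = s * complex.Re z.
  by case: z => a b /=; rewrite mul0r subr0.
have ReD (z z' : R[i]) : complex.Re (z + z') = complex.Re z + complex.Re z'.
  by case: z z' => a b [].
pose q v : R := normR (j v) ^+ 2 - 2 * complex.Re (f v).
(* completing the square in [normR (j v) - c] *)
have qlb v : - c ^+ 2 <= q v.
  have : complex.Re (f v) <= c * normR (j v).
    apply: le_trans (ler_norm _) _; apply: re_norm; rewrite rmorphM /= -normRE.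
    exact: fbd.
  by rewrite /q; have := sqr_ge0 (normR (j v) - c); nra.
have qinf : has_inf (range q).
  split; first by exists (q 0); exists 0.
  by exists (- c ^+ 2) => _ [v _ <-].
pose m := inf (range q).
have mq v : m <= q v by apply: ge_inf qinf.2 _ _; exists v.
have min_seq n : exists v, q v < m + n.+1%:R^-1.
  by have [|_ [v _ <-] hv] := inf_adherent (eps := n.+1%:R^-1) _ qinf;
    [rewrite invr_gt0 | exists v].
have [v hv] := choice min_seq.
have qline (u w : V) (s : R) : q (u + s%:C *: w) =
    q u + 2 * s * (re_inner (j w) (j u) - complex.Re (f w))
    + s ^+ 2 * normR (j w) ^+ 2.
  rewrite /q -!re_innerxx jD jZ fD fZ /re_inner.
  rewrite innerDl !innerDr !innerZl !innerZr !ReD.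
  rewrite conj_realC !ReZ -!/(re_inner _ _) (re_innerC (j u) (j w)); ring.
have normB h k : normR (h - k) ^+ 2 =
    2 * normR h ^+ 2 + 2 * normR k ^+ 2 - normR (h + k) ^+ 2.
  rewrite -!re_innerxx /re_inner !innerDl !innerDr -scaleN1r !innerZl !innerZr.
  rewrite rmorphN rmorph1 !mulN1r opprK !ReD !raddfN /=; ring.
have min_close u w : normR (j u - j w) ^+ 2 <= 2 * (q u - m) + 2 * (q w - m).
  have := mq ((2^-1)%:C *: (u + w)); rewrite normB /q jZ fZ jD fD ReZ ReD.
  have -> : normR ((2^-1)%:C *: (j u + j w)) ^+ 2 = 4^-1 * normR (j u + j w) ^+ 2.
    rewrite -!re_innerxx /re_inner innerZl innerZr.
    by rewrite conj_realC !ReZ; field.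
  by lra.
have small (r : R) : 0 < r -> exists N, forall n, (N <= n)%N -> q (v n) - m < r.
  move=> /ltr_add_invr [N]; rewrite add0r => hN; exists N => n Nn.
  rewrite ltrBlDl; apply: lt_le_trans (hv n) _; rewrite lerD2l.
  by apply: le_trans (ltW hN); rewrite lef_pV2 ?posrE // ler_nat.
have real_eps (e : R[i]) : 0 < e -> exists2 r : R, 0 < r & e = r%:C.
  move=> e0; exists (complex.Re e); last by rewrite RRe_real // gtr0_real.
  by move: e0; rewrite ltcE => /andP[].
have jv_cvg : cvg ((j \o v) @ \oo).
  apply/cauchy_cvgP/cauchyP => e /real_eps [r r0 ->].
  have [|N hN] := small (r ^+ 2 / 4); first by rewrite divr_gt0 ?exprn_gt0.
  exists (j (v N)), N => // n /= Nn; rewrite -ball_normE /= normRE ltcR.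
  rewrite -(ltr_pXn2r (n := 2)) ?nnegrE ?normR_ge0 ?ltW //.
  apply: le_lt_trans (min_close _ _) _.
  by have := hN _ Nn; have := hN _ (leqnn N); lra.
pose y := lim ((j \o v) @ \oo).
suff fE u : f u = inner (j u) y.
  by exists y => //; apply: dense_norm_le => // u; rewrite -fE.
have jv_near (e : R) : 0 < e ->
    exists2 n, normR (j (v n) - y) < e & q (v n) - m < e ^+ 2.
  move=> e0; have [N hN] := small _ (exprn_gt0 2 e0).
  have /cvgrPdist_lt/(_ e%:C) := jv_cvg; rewrite ltcR => /(_ e0) [N' _ hN'].
  exists (maxn N N'); last by apply: hN; rewrite leq_maxl.
  by have := hN' _ (leq_maxr N N'); rewrite /= distrC normRE ltcR.
have reE w : complex.Re (f w) = complex.Re (inner (j w) y).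
  apply/eqP; rewrite -subr_eq0 -normr_eq0 eq_le normr_ge0 andbT.
  set b := normR (j w) ^+ 2; have b0 : 0 <= b by rewrite sqr_ge0.
  apply: (@le0_of_leM_eps _ _ (normR (j w) + (b + 1))) => e e0.
  have [n hy hq] := jv_near e e0.
  set X := re_inner (j w) (j (v n)) - complex.Re (f w).
  (* minimality at [v n] in the direction [w], with the step that is optimal up
     to the [+ 1] which keeps the denominator positive *)
  have hX : `|X| <= e * (b + 1).
    set t := X / (b + 1).
    have Xt : X = t * (b + 1) by rewrite mulfVK ?gt_eqF ?ltr_wpDl.
    have := mq (v n + (- t)%:C *: w); rewrite qline -/X -/b => hm.
    have ht : t ^+ 2 * (b + 1) <= e ^+ 2 by rewrite Xt in hm; nra.
    have b1 : 0 <= b + 1 by rewrite addr_ge0.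
    rewrite Xt normrM (ger0_norm b1) ler_wpM2r //.
    rewrite -ler_sqr ?nnegrE ?normr_ge0 ?(ltW e0) // real_normK ?num_real //.
    by apply: le_trans ht; rewrite ler_peMr ?sqr_ge0 // lerDr.
  have hI : `|re_inner (j w) (j (v n) - y)| <= normR (j w) * e.
    apply: re_norm; apply: le_trans (inner_CauchySchwarz _ _) _.
    by rewrite !normRE -rmorphM lecR ler_wpM2l // ltW.
  have -> : complex.Re (f w) - complex.Re (inner (j w) y)
      = re_inner (j w) (j (v n) - y) - X.
    by rewrite /X /re_inner innerBr raddfB /=; ring.
  apply: le_trans (ler_normB _ _) _; rewrite mulrDl lerD //.
  by rewrite mulrC.
(* the real part of [f ('i *: u)] is the opposite of the imaginary part of
   [f u] *)
have := reE u; have := reE ('i *: u); rewrite fZ jZ innerZl.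
case: (f u) (inner _ _) => a b [a' b'] /=.
by rewrite !mul0r !mul1r !sub0r => /oppr_inj -> ->.
Qed.

Lemma bounded_op_dense_eq T T' : bounded_op T -> bounded_op T' ->
  (forall v, T (j v) = T' (j v)) -> T = T'.
Proof.
move=> bT bT' TT'; apply/funext => h; apply/eqP; rewrite -subr_eq0; apply/eqP.
have [c c0 hc] := bounded_op_bound bT; have [c' c'0 hc'] := bounded_op_bound bT'.
apply: (@eq0_of_normrM_eps _ _ _ (c + c')) => [|e e0].
  by rewrite addr_ge0 // ltW.
have [v /ltW hv] := dense_approx h e0.
have -> : T h - T' h = T (h - j v) - T' (h - j v).
  rewrite (zmod_morphism_linear bT.1) (zmod_morphism_linear bT'.1) TT' opprB addrA.
  by rewrite subrK.
apply: le_trans (ler_normB _ _) _; rewrite mulrDl; apply: lerD.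
  by apply: le_trans (hc _) _; rewrite ler_wpM2l // ltW.
by apply: le_trans (hc' _) _; rewrite ler_wpM2l // ltW.
Qed.

(** Riesz representation in both variables: [B a b = inner (j a) (S b)] defines
    [S] on [V] only, but for every [h], [T h] represents [b |-> inner (S b) h]. *)
Lemma bounded_form_operator (B : V -> V -> R[i]) (c : R) :
  positive_form B -> 0 <= c ->
  (forall a b, `|B a b| <= c%:C * (`|j a| * `|j b|)) ->
  exists T, [/\ bounded_op T, adjoint_op T T, (forall h, 0 <= inner (T h) h) &
    forall a b, B a b = inner (j a) (T (j b))].
Proof.
move=> Bpos c0 Bbd; have [Bl Br Bp] := Bpos.
have hS b : exists s, (forall a, B a b = inner (j a) s) /\ `|s| <= c%:C * `|j b|.
  have [|||s hs1 hs2] := @Riesz_dense (fun a => B a b) (c * normR (j b)).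
  - by rewrite mulr_ge0.
  - by move=> d x y; rewrite Bl.
  - by move=> a; rewrite rmorphM /= -normRE -mulrA [`|j b| * _]mulrC.
  - by exists s; split => //; move: hs2; rewrite rmorphM /= -normRE.
have [S SP] := choice hS.
have Slin : linear S.
  move=> d a b; apply: dense_inner_ext => u.
  by rewrite inner_linear_r -!(SP _).1 Br.
have hT h : exists t,
    (forall b, inner (S b) h = inner (j b) t) /\ `|t| <= c%:C * `|h|.
  have [|||t ht1 ht2] := @Riesz_dense (fun b => inner (S b) h) (c * normR h).
  - by rewrite mulr_ge0.
  - by move=> d a b; rewrite Slin inner_linear.
  - move=> b; apply: le_trans (inner_CauchySchwarz _ _) _.
    by rewrite rmorphM /= -normRE -mulrA [`|h| * _]mulrC mulrA ler_wpM2r // (SP b).2.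
  - by exists t; split => //; move: ht2; rewrite rmorphM /= -normRE.
have [T TP] := choice hT.
have Tlin : linear T.
  move=> d h k; apply: dense_inner_ext => u.
  by rewrite inner_linear_r -!(TP _).1 inner_linear_r.
have c0' : 0 <= c%:C by rewrite lecR.
have TB a b : B a b = inner (j a) (T (j b)).
  by rewrite -(TP _).1 innerC -(SP _).1 -(positive_form_hermitian Bpos).
have TBpos h : 0 <= inner (T h) h.
  apply: complex_ge0_closed => e e0.
  (* [K * `|h - j v|] bounds the change of [inner (T h) h] when [`|h - j v| <= 1];
     the distance [e / (K + e)] is at most [1] and makes it at most [e] *)
  pose K := c%:C * (2 * `|h| + 1).
  have K0 : 0 <= K by rewrite mulr_ge0 // addr_ge0 // mulr_ge0.
  have Ke : 0 < K + e by rewrite ltr_wpDl.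
  have [v hv] := dense_approx h (divr_gt0 e0 Ke).
  set d := h - j v in hv.
  exists (inner (T (j v)) (j v)); first by rewrite innerC -TB conjc_ge0.
  have d1 : `|d| <= 1.
    by apply: le_trans (ltW hv) _; rewrite ler_pdivrMr // mul1r lerDr.
  have hjv : `|j v| <= `|h| + 1.
    rewrite -[j v](subrK h) addrC; apply: le_trans (ler_normD _ _) _.
    by rewrite lerD2l distrC.
  have -> : inner (T h) h - inner (T (j v)) (j v)
      = inner (T d) h + inner (T (j v)) d.
    by rewrite /d (zmod_morphism_linear Tlin) innerBl innerBr addrA subrK.
  have hK : `|d| * K <= e.
    apply: le_trans (ler_wpM2r K0 (ltW hv)) _.
    by rewrite mulrAC ler_pdivrMr // (ler_wpM2l (ltW e0)) // lerDl ltW.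
  apply: le_trans hK; apply: le_trans (ler_normD _ _) _.
  have -> : `|d| * K = c%:C * `|d| * `|h| + c%:C * (`|h| + 1) * `|d|.
    by rewrite /K; ring.
  apply: lerD; apply: le_trans (inner_CauchySchwarz _ _) _.
    by rewrite ler_wpM2r // (TP _).2.
  by rewrite ler_wpM2r //; apply: le_trans (TP _).2 _; rewrite ler_wpM2l.
exists T; split=> //.
- by apply: (@bound_bounded_op _ _ _ c%:C) => // x; exact: (TP x).2.
- have Tform : positive_form (fun h k => inner (T h) k).
    split=> // d x y z; first by rewrite Tlin inner_linear.
    by rewrite inner_linear_r.
  by move=> h k; rewrite (positive_form_hermitian Tform) -innerC.
Qed.

End DenseRange.

(** * Operator algebras and weak limits *)

Section OperatorAlgebras.
Variables (R : realType) (H : hilbertType R).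
Implicit Types (S X : set (H -> H)) (T Y : H -> H) (P : set (set (H -> H))).

Lemma op_cstar_algebra_meet P : P !=set0 ->
  (forall S, P S -> op_cstar_algebra S) ->
  op_cstar_algebra [set T | forall S, P S -> S T].
Proof.
move=> [S0 PS0] PC; split.
- by move=> T hT; have [+ _ _ _ _] := PC _ PS0; apply; exact: hT.
- by move=> S /PC[].
- move=> c T T' hT hT' S PS; have [_ _ lin _ _] := PC _ PS.
  by apply: lin; [exact: hT | exact: hT'].
- split=> [T T' hT hT' S PS | T T' hT bT' adj S PS];
    have [_ _ _ [mul adjC] _] := PC _ PS.
    by apply: mul; [exact: hT | exact: hT'].
  by apply: adjC adj => //; exact: hT.
- move=> T bT hT S PS; have [_ _ _ _ clos] := PC _ PS; apply: clos => // e e0.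
  by have [T' hT' h] := hT e e0; exists T' => //; exact: hT'.
Qed.

Lemma commutant_op_cstar X : X `<=` @bounded_op R H ->
  star_closed (commutant X) -> op_cstar_algebra (commutant X).
Proof.
move=> Xb Xstar; split.
- by move=> T [].
- by split; [exact: bounded_op_id | move=> Y _; apply/funext].
- move=> c T T' [bT hT] [bT' hT']; split; first exact: bounded_op_comb.
  move=> Y XY; apply/funext => x /=; have [Ylin _] := Xb _ XY; rewrite Ylin.
  have /(congr1 (@^~ x))/= -> := hT _ XY.
  by have /(congr1 (@^~ x))/= -> := hT' _ XY.
- split=> // T T' [bT hT] [bT' hT']; split; first exact: bounded_op_comp.
  move=> Y XY; apply/funext => x /=.
  have /(congr1 (@^~ x))/= -> := hT' _ XY.
  by have /(congr1 (@^~ (T' x)))/= -> := hT _ XY.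
- move=> T bT hT; split=> // Y XY; apply/funext => x /=.
  have bY := Xb _ XY; have [c c0 hc] := bounded_op_bound bY.
  apply/eqP; rewrite -subr_eq0; apply/eqP.
  apply: (@eq0_of_normrM_eps _ _ _ (`|Y x| + c * `|x|)).
    by rewrite addr_ge0 // mulr_ge0 // ltW.
  move=> e e0; have [T' [_ cT'] hT'] := hT e e0.
  have /(congr1 (@^~ x))/= T'Y := cT' _ XY.
  rewrite -(subrKA (T' (Y x))); apply: le_trans (ler_normD _ _) _.
  rewrite mulrDl [`|Y x| * e]mulrC lerD //.
  rewrite T'Y -(zmod_morphism_linear bY.1); apply: le_trans (hc _) _.
  by rewrite -mulrA ler_wpM2l ?(ltW c0) // distrC [`|x| * e]mulrC.
Qed.

Lemma von_neumann_op_cstar S : von_neumann_algebra S -> op_cstar_algebra S.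
Proof.
move=> [Sb Sstar SE]; rewrite -SE; apply: commutant_op_cstar; first by move=> T [].
by rewrite SE.
Qed.

(** A commutant is equal to its bicommutant; self-adjointness of [T] makes it
    closed under adjoints. *)
Lemma commutant_selfadjoint_von_neumann T :
  bounded_op T -> adjoint_op T T -> von_neumann_algebra (commutant [set T]).
Proof.
move=> bT adjT; split; first by move=> Y [].
- move=> Y Y' [bY hY] bY' adjY; split=> // _ ->; apply/funext => y /=.
  apply: inner_ext => z; rewrite -adjY -!adjT -adjY.
  by have /(congr1 (@^~ z))/= -> := hY _ erefl.
- apply/seteqP; split=> Y [bY hY]; split=> //.
    move=> _ ->; apply: hY; split=> // Z [_ hZ].
    by rewrite hZ.
  by move=> Z [_ hZ]; rewrite hZ.
Qed.

Lemma vn_generated_op_cstar X :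
  X `<=` @bounded_op R H -> op_cstar_algebra (vn_generated X).
Proof.
move=> Xb.
have -> : vn_generated X =
    [set T | forall S, [set S | von_neumann_algebra S /\ X `<=` S] S -> S T].
  by apply/seteqP; split=> T hT S; [case; exact: hT | move=> *; exact: hT].
apply: op_cstar_algebra_meet => [|S [/von_neumann_op_cstar]//].
(* the commutant of the identity consists of all bounded operators *)
exists (commutant [set idfun]); split.
  by apply: commutant_selfadjoint_von_neumann; first exact: bounded_op_id.
by move=> T /Xb bT; split=> // _ ->; apply/funext.
Qed.

Lemma wot_cvg_near (u : nat -> H -> H) T : wot_cvg u T ->
  forall x y (e : R[i]), 0 < e ->
  exists N, forall n, (N <= n)%N -> `|inner (T x) y - inner (u n x) y| <= e.
Proof.
move=> uT x y e e0; have /cvgrPdist_le/(_ e e0) [N _ hN] := uT x y.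
by exists N => n /hN.
Qed.

Lemma wot_cvg_eq (u u' : nat -> H -> H) T T' x y : wot_cvg u T -> wot_cvg u' T' ->
  (exists N, forall n, (N <= n)%N -> inner (u n x) y = inner (u' n x) y) ->
  inner (T x) y = inner (T' x) y.
Proof.
move=> uT uT' [N hN]; apply/eqP; rewrite -subr_eq0; apply/eqP.
apply: (@eq0_of_normrM_eps _ _ _ 2) => // e e0.
have [N1 h1] := wot_cvg_near uT x y e0; have [N2 h2] := wot_cvg_near uT' x y e0.
pose n := maxn N (maxn N1 N2).
rewrite -(subrKA (inner (u n x) y)); apply: le_trans (ler_normD _ _) _.
rewrite mulrDl mul1r lerD //; first by apply: h1; rewrite /n !leq_max leqnn !orbT.
by rewrite hN ?leq_maxl // distrC; apply: h2; rewrite /n !leq_max leqnn !orbT.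
Qed.

Lemma wot_cvg_const T : wot_cvg (fun=> T) T.
Proof. by move=> x y; exact: cvg_cst. Qed.

Lemma wot_cvg_unique (u : nat -> H -> H) T T' :
  wot_cvg u T -> wot_cvg u T' -> T = T'.
Proof.
move=> uT uT'; apply/funext => x; apply: inner_ext => y.
by rewrite innerC [RHS]innerC; congr Num.conj; apply: wot_cvg_eq uT uT' _; exists 0.
Qed.

Lemma wot_cvg_comb (u u' : nat -> H -> H) T T' (c : R[i]) :
  wot_cvg u T -> wot_cvg u' T' ->
  wot_cvg (fun n x => c *: u n x + u' n x) (fun x => c *: T x + T' x).
Proof.
move=> uT uT' x y; rewrite inner_linear.
under eq_fun do rewrite inner_linear.
by apply: cvgD; [apply: cvgM; [exact: cvg_cst | exact: uT] | exact: uT'].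
Qed.

Lemma wot_cvg_ge0 (u : nat -> H -> H) T x : wot_cvg u T ->
  (forall n, 0 <= inner (u n x) x) -> 0 <= inner (T x) x.
Proof.
move=> uT upos; apply: complex_ge0_closed => e /(wot_cvg_near uT x x) [N hN].
by exists (inner (u N x) x) => //; exact: hN.
Qed.

Lemma wot_cvg_norm (u : nat -> H -> H) T (r : R[i]) x : wot_cvg u T -> 0 <= r ->
  (forall n, `|u n x| <= r) -> `|T x| <= r.
Proof.
move=> uT r0 ur.
have [->|Tx0] := eqVneq (T x) 0; first by rewrite normr0.
have Tx : 0 < `|T x| by rewrite normr_gt0.
rewrite -(ler_pM2r Tx) -expr2 -inner_norm -subr_ge0.
apply: complex_ge0_closed => e e0; have [N hN] := wot_cvg_near uT x (T x) e0.
exists (r * `|T x| + e - inner (T x) (T x)); last first.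
  set a := r * _; set b := inner _ _.
  have -> : a - b - (a + e - b) = - e by ring.
  by rewrite normrN gtr0_norm.
rewrite subr_ge0 inner_norm -[leLHS]gtr0_norm ?exprn_gt0 // -inner_norm.
rewrite -[X in `|X|](subrK (inner (u N x) (T x))) addrC.
apply: le_trans (ler_normD _ _) _; apply: lerD; last exact: hN.
by apply: le_trans (inner_CauchySchwarz _ _) _; rewrite ler_wpM2r.
Qed.

End OperatorAlgebras.

(** * States and representations *)

Section Representations.
Variables (R : realType) (U : cstarAlgType R) (H : hilbertType R).
Implicit Types (f : U -> R[i]) (p : U -> H -> H).

Definition star_representation p : Prop :=
  [/\ (forall a, bounded_op (p a)), p 1 = idfun,
      (forall (c : R[i]) a b, p (c *: a + b) = (fun x => c *: p a x + p b x)),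
      (forall a b, p (a * b) = p a \o p b) &
      (forall a, adjoint_op (p a) (p (star a)))].

Lemma positive_functional_form f :
  scalar f -> (forall x, 0 <= f (star x * x)) ->
  positive_form (fun x y => f (star y * x)).
Proof.
move=> flin fpos; split=> // c x y z.
  by rewrite mulrDr -scalerAr flin.
by rewrite star_linear mulrDl -scalerAl flin.
Qed.

(** Contractivity comes for free, without any continuity of [p], from the bound
    on the positive functional [fun y => inner (p y h) h]. *)
Lemma star_representation_norm p a h :
  star_representation p -> `|p a h| <= (cnorm a)%:C * `|h|.
Proof.
move=> [_ p1 plin pmul padj].
pose f x := inner (p x h) h.
have fE y : f (star y * y) = `|p y h| ^+ 2.
  by rewrite /f pmul /= padj starK inner_norm.
have flin : scalar f by move=> c x y; rewrite /f plin inner_linear.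
have := positive_functional_bound (f := f) a flin.
rewrite fE {2}/f p1 inner_norm rmorphXn -exprMn.
rewrite ler_pXn2r ?nnegrE ?mulr_ge0 ?lecR ?cnorm_ge0 //.
by apply=> y; rewrite fE exprn_ge0.
Qed.

End Representations.

(** * Words *)

Section Words.
Variables (R : realType) (A U : cstarAlgType R).
Variable lam : nat -> {lrmorphism A -> U}.
Hypothesis hU : universal_free_product lam.
Implicit Types (w : seq (nat * A)).

Definition word w : U := \prod_(p <- w) lam p.1 p.2.

Definition reindex (s : nat -> nat) w := [seq (s p.1, p.2) | p <- w].

Definition star_word w := rev [seq (p.1, star p.2) | p <- w].

Lemma word_cat w1 w2 : word (w1 ++ w2) = word w1 * word w2.
Proof. by rewrite /word big_cat. Qed.

Lemma word_cons i a w : word ((i, a) :: w) = lam i a * word w.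
Proof. by rewrite /word big_cons. Qed.

Lemma star_wordE w : star (word w) = word (star_word w).
Proof.
have [lam_star _ _] := hU.
elim: w => [|[i a] w IH]; first by rewrite /word !big_nil star1.
rewrite word_cons starM IH /star_word /= rev_cons -cats1 word_cat; congr (_ * _).
by rewrite -lam_star /word big_seq1.
Qed.

(** The linear span of the words is a *-subalgebra, so that it is dense.  The
    property [P] itself is not assumed to be multiplicative: the smallest set with
    the three closure properties is shown to be a C*-subalgebra. *)
Lemma words_total (P : set U) :
  (forall (c : R[i]) x y, P x -> P y -> P (c *: x + y)) ->
  (forall w, P (word w)) ->
  (forall x, (forall e : R, 0 < e -> exists2 y, P y & cnorm (x - y) < e) -> P x) ->
  forall x, P x.
Proof.
pose good (Q : set U) := [/\ forall (c : R[i]) x y, Q x -> Q y -> Q (c *: x + y),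
  forall w, Q (word w) &
  forall x, (forall e : R, 0 < e -> exists2 y, Q y & cnorm (x - y) < e) -> Q x].
move=> Plin Pword Pclosed x.
pose M := [set x | forall Q, good Q -> Q x].
suff Mx : M x by apply: Mx.
have Mgood : good M.
  split=> [c y z My Mz Q gQ|w Q []//|y My Q gQ]; have [Ql _ Qc] := gQ.
    by apply: Ql; [exact: My | exact: Mz].
  by apply: Qc => e /My [z Mz]; exists z => //; exact: Mz.
have [Ml Mw Mc] := Mgood.
have good_preim (g : U -> U) (k : R) : 0 < k ->
    (forall (c : R[i]) y z, exists d, g (c *: y + z) = d *: g y + g z) ->
    (forall y z, cnorm (g y - g z) <= k * cnorm (y - z)) ->
    (forall w, M (g (word w))) -> good [set y | M (g y)].
  move=> k0 glin gk gw; split=> //= [c y z My Mz|y hy].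
    by have [d ->] := glin c y z; exact: Ml.
  apply: Mc => e e0; have [z Mz hz] := hy (e / k) (divr_gt0 e0 k0).
  exists (g z) => //; apply: le_lt_trans (gk _ _) _.
  by rewrite mulrC -ltr_pdivlMr.
suff -> : M = setT by [].
have [_ gen _] := hU; apply: gen; last first.
  by move=> i a; have := Mw [:: (i, a)]; rewrite /word big_seq1.
have kpos (y : U) : 0 < cnorm y + 1 by rewrite ltr_wpDl ?cnorm_ge0.
have mulw w y : M y -> M (word w * y).
  move=> My; apply: (My [set y | M (word w * y)]).
  apply: (good_preim (fun y => word w * y) _ (kpos (word w))) => //.
  - by move=> c u v; exists c; rewrite mulrDr -scalerAr.
  - move=> u v; rewrite -mulrBr; apply: le_trans (cnormM _ _) _.
    by rewrite ler_wpM2r ?cnorm_ge0 // lerDl.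
  - by move=> w'; rewrite -word_cat.
split=> //.
- by have := Mw [::]; rewrite /word big_nil.
- move=> u v Mu Mv; apply: (Mu [set u | M (u * v)]).
  apply: (good_preim (fun u => u * v) _ (kpos v)) => //.
  - by move=> c y z; exists c; rewrite mulrDl -scalerAl.
  - move=> y z; rewrite -mulrBl; apply: le_trans (cnormM _ _) _.
    by rewrite mulrC ler_wpM2r ?cnorm_ge0 // lerDl.
  - by move=> w; exact: mulw.
- move=> y My; apply: (My [set y | M (star y)]).
  apply: (good_preim _ 1) => // [c u v|u v|w].
  + by exists (Num.conj c); rewrite star_linear.
  + by rewrite mul1r -starN -starD cnorm_starE.
  + by rewrite star_wordE.
Qed.

Lemma eq_on_words (f g : U -> R[i]) (k l : R[i]) :
  0 <= k -> 0 <= l -> scalar f -> scalar g ->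
  (forall x, `|f x| <= k * (cnorm x)%:C) ->
  (forall x, `|g x| <= l * (cnorm x)%:C) ->
  (forall w, f (word w) = g (word w)) -> forall x, f x = g x.
Proof.
move=> k0 l0 flin glin fk gl fg; apply: words_total => //.
  by move=> c x y fx fy; rewrite flin glin fx fy.
move=> x hx; apply/eqP; rewrite -subr_eq0; apply/eqP.
apply: (@eq0_of_normrM_eps _ _ _ (k + l)) => [|e e0]; first exact: addr_ge0.
have er : e = (complex.Re e)%:C by rewrite RRe_real // gtr0_real.
have [|z fz hz] := hx (complex.Re e); first by rewrite -ltcR -er.
have -> : f x - g x = f (x - z) - g (x - z).
  by rewrite (zmod_morphism_linear flin) (zmod_morphism_linear glin) fz; ring.
have hze : (cnorm (x - z))%:C <= e by rewrite er lecR ltW.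
rewrite mulrDl; apply: le_trans (ler_normB _ _) _; apply: lerD.
  by apply: le_trans (fk _) _; rewrite ler_wpM2l.
by apply: le_trans (gl _) _; rewrite ler_wpM2l.
Qed.

End Words.

(** * Symmetric states on words *)

Section SymmetricStates.
Variables (R : realType) (A U : cstarAlgType R).
Variable lam : nat -> {lrmorphism A -> U}.
Variable psi : U -> R[i].
Hypothesis psi_sym : symmetric_states lam psi.
Implicit Types (w u v : seq (nat * A)).

Lemma symmetric_reindex s w : bijective s ->
  psi (word lam w) = psi (word lam (reindex s w)).
Proof. by move=> sbij; rewrite [in RHS]/word big_map; exact: psi_sym.2. Qed.

Lemma eq_reindex s t w : (forall p, p \in w -> s p.1 = t p.1) ->
  reindex s w = reindex t w.
Proof. by move=> st; apply/eq_in_map => p /st ->. Qed.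

Lemma letters_bounded w : exists N, forall p, p \in w -> (p.1 < N)%N.
Proof.
exists (\max_(p <- w) p.1).+1 => p pw.
by rewrite ltnS; apply: (@leq_bigmax_seq _ _ xpredT (fun p : nat * A => p.1)).
Qed.

(** The shift is no permutation, but on the finitely many letters of a word it
    agrees with the exchange of two adjacent blocks of indices. *)
Lemma symmetric_shift n w :
  psi (word lam w) = psi (word lam (reindex (addn n) w)).
Proof.
have [N hN] := letters_bounded w.
pose s i := (if i < N then n + i else if i < N + n then i - N else i)%N.
pose t i := (if i < n then i + N else if i < N + n then i - n else i)%N.
have sbij : bijective s.
  exists t => i; rewrite /s /t;
    by case: (ltnP i N) (ltnP i n) (ltnP i (N + n)) => ? [] ? [] ?;
    do ?[case: ltnP => ?]; lia.
rewrite (symmetric_reindex w sbij); congr (psi (word lam _)).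
by apply: eq_reindex => p /hN; rewrite /s => ->.
Qed.

(** Permuting the indices of a word that has been moved beyond those of its
    context is itself a permutation of the indices that fixes the context. *)
Lemma symmetric_shifted_reindex u v w s : bijective s ->
  exists N, forall n, (N <= n)%N ->
    psi (word lam (u ++ reindex (addn n) w ++ v)) =
    psi (word lam (u ++ reindex (addn n) (reindex s w) ++ v)).
Proof.
move=> [t st ts]; have [N hN] := letters_bounded (u ++ v).
exists N => n Nn.
pose s' i := (if i < n then i else n + s (i - n))%N.
pose t' i := (if i < n then i else n + t (i - n))%N.
have sbij : bijective s'.
  exists t' => i; rewrite /s' /t'; case: (ltnP i n) => [-> //|ni].
    by rewrite ltnNge leq_addr /= addKn st subnKC.
  by rewrite ltnNge leq_addr /= addKn ts subnKC.
have fixed w' : {subset w' <= u ++ v} -> reindex s' w' = w'.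
  move=> sub; rewrite -[RHS]map_id; apply/eq_in_map => -[i a] /sub /hN /= iN.
  by rewrite /s' (leq_trans iN Nn).
rewrite (symmetric_reindex _ sbij) /reindex !map_cat.
congr (psi (word lam (_ ++ _ ++ _))).
- by apply: fixed => p; rewrite mem_cat => ->.
- rewrite -!map_comp; apply: eq_map => -[i a] /=.
  by rewrite /s' ltnNge leq_addr /= addKn.
- by apply: fixed => p; rewrite mem_cat orbC => ->.
Qed.

End SymmetricStates.

(** * The tail expectation *)

Section TailExpectation.
Variables (R : realType) (A U : cstarAlgType R) (H : hilbertType R).
Variables (lam : nat -> {lrmorphism A -> U}) (pi : U -> H -> H).
Variables (alpha F : (H -> H) -> (H -> H)).
Hypothesis hU : universal_free_product lam.
Hypothesis pi_rep : star_representation pi.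
Hypothesis halpha : tail_shift lam pi alpha.
Hypothesis hF : tail_expectation lam pi alpha F.

Local Notation Q := (tail_Q lam pi).
Local Notation tail := (tail_algebra lam pi).
Local Notation D := (tail_cstar_algebra lam pi F).

Lemma tail_op_cstar : op_cstar_algebra tail.
Proof.
have [pib _ _ _ _] := pi_rep.
have -> : tail = [set T | forall S, range (fun N =>
    vn_generated [set T | exists i a, (N <= i)%N /\ T = pi (lam i a)]) S -> S T].
  apply/seteqP; split=> T hT; first by move=> _ [N _ <-]; exact: hT.
  by move=> N _; apply: hT; exists N.
apply: op_cstar_algebra_meet => [|_ [N _ <-]].
  by eexists; exists 0%N.
by apply: vn_generated_op_cstar => _ [i [a [_ ->]]].
Qed.

Lemma tail_Q_op_cstar : op_cstar_algebra Q.
Proof.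
have [pib _ _ _ _] := pi_rep.
have -> : Q = [set T | forall S,
    [set S | op_cstar_algebra S /\ tail `|` range pi `<=` S] S -> S T].
  by apply/seteqP; split=> T hT S; [case; exact: hT | move=> *; exact: hT].
apply: op_cstar_algebra_meet => [|S []//].
have bounded_vn : op_cstar_algebra (commutant [set @idfun H]).
  by apply/von_neumann_op_cstar/commutant_selfadjoint_von_neumann => //;
    exact: bounded_op_id.
exists (commutant [set @idfun H]); split=> // T hT; split=> [|_ ->].
  by case: hT => [|[a _ <-]]; [have [tb _ _ _ _] := tail_op_cstar; exact: tb |].
by apply/funext.
Qed.

Lemma tail_sub_Q : tail `<=` Q.
Proof. by move=> T tT S _; apply; left. Qed.

Lemma pi_Q a : Q (pi a).
Proof. by move=> S _; apply; right; exists a. Qed.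

(** Iterating [alpha] on [pi] gives *-representations of [U], hence contractions,
    although no continuity is known of [alpha]. *)
Lemma alpha_rep (p : U -> H -> H) : star_representation p -> (forall a, Q (p a)) ->
  star_representation (fun a => alpha (p a)).
Proof.
move=> [pb p1 pl pm pa] pQ.
have [[aQ al am aa] ash _] := halpha; have [Qb _ _ _ _] := tail_Q_op_cstar.
have [_ pi1 _ _ _] := pi_rep.
split.
- by move=> a; apply: Qb; apply: aQ; exact: pQ.
- by rewrite p1 -pi1 -(rmorph1 (lam 0)) ash !rmorph1.
- by move=> c a b; rewrite pl al.
- by move=> a b; rewrite pm am.
- by move=> a; apply: aa.
Qed.

Definition shift_rep n (a : U) := iter n alpha (pi a).

Lemma shift_rep_Q n a : Q (shift_rep n a).
Proof.
have [[aQ _ _ _] _ _] := halpha.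
by elim: n => [|n IH]; [exact: pi_Q | exact: aQ].
Qed.

Lemma shift_repP n : star_representation (shift_rep n).
Proof.
elim: n => [//|n IH]; apply: alpha_rep => // a; exact: shift_rep_Q.
Qed.

Lemma shift_rep_word n w :
  shift_rep n (word lam w) = pi (word lam (reindex (addn n) w)).
Proof.
have [_ pi1 _ pim _] := pi_rep; have [_ ash _] := halpha.
have letter i a : shift_rep n (lam i a) = pi (lam (n + i)%N a).
  rewrite /shift_rep; elim: n => [//|n IH] /=.
  by rewrite -/(iter n alpha _) IH ash.
have [_ s1 _ sm _] := shift_repP n.
elim: w => [|[i a] w IH]; first by rewrite /word !big_nil s1 pi1.
by rewrite /= !word_cons sm IH pim letter.
Qed.

Lemma expectation_cvg a : wot_cvg (fun n => shift_rep n a) (F (pi a)).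
Proof. by have [_] := hF (pi_Q a). Qed.

Lemma expectation_comb (c : R[i]) a b :
  F (pi (c *: a + b)) = (fun x => c *: F (pi a) x + F (pi b) x).
Proof.
apply: wot_cvg_unique (@expectation_cvg _) _.
have -> : (fun n => shift_rep n (c *: a + b)) =
    (fun n x => c *: shift_rep n a x + shift_rep n b x).
  by apply/funext => n; have [_ _ -> _ _] := shift_repP n.
exact: wot_cvg_comb (@expectation_cvg a) (@expectation_cvg b).
Qed.

Lemma expectation_norm a h : `|F (pi a) h| <= (cnorm a)%:C * `|h|.
Proof.
apply: wot_cvg_norm (@expectation_cvg a) _ _ => [|n].
  by rewrite mulr_ge0 // lecR cnorm_ge0.
exact: star_representation_norm (shift_repP n).
Qed.

Lemma expectation_ge0 a h : 0 <= inner (F (pi (star a * a)) h) h.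
Proof.
apply: wot_cvg_ge0 (@expectation_cvg _) _ => n.
have [_ _ _ sm sa] := shift_repP n.
by rewrite sm /= sa starK inner_norm exprn_ge0.
Qed.

Lemma expectation_tail T : tail T -> F T = T.
Proof.
move=> tT; have [_ _ afix] := halpha; have [_ FT] := hF (tail_sub_Q tT).
apply: wot_cvg_unique FT _.
have -> : (fun n => iter n alpha T) = (fun=> T).
  by apply/funext; elim=> [//|n IH] /=; rewrite IH afix.
exact: wot_cvg_const.
Qed.

Lemma expectation_sub a b x :
  F (pi a) x - F (pi b) x = F (pi (a - b)) x.
Proof.
by rewrite addrC -scaleN1r -[in RHS](addrC (- b)) -(scaleN1r b) expectation_comb.
Qed.

Lemma expectation_Q_tail T : Q T -> tail (F T).
Proof. by case/hF. Qed.

Lemma tail_word_closed_tail : tail_word_closed lam pi F tail.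
Proof.
move=> w i a; apply: expectation_Q_tail.
have [_ _ _ [mul _] _] := tail_Q_op_cstar.
elim: w => [|[[k b] T] w IH]; first exact: pi_Q.
apply: (mul (pi (lam k b) \o val T)) IH; apply: mul; first exact: pi_Q.
exact: tail_sub_Q (set_mem (valP T)).
Qed.

Lemma tail_cstar_op_cstar : op_cstar_algebra D.
Proof.
have -> : D = [set T | forall S, [set S | [/\ op_cstar_algebra S, S `<=` tail &
    tail_word_closed lam pi F S]] S -> S T].
  by apply/seteqP; split=> T hT S; [case; exact: hT | move=> *; exact: hT].
apply: op_cstar_algebra_meet => [|S []//].
exists tail; split=> //; [exact: tail_op_cstar | exact: tail_word_closed_tail].
Qed.

Lemma tail_cstar_sub_tail : D `<=` tail.
Proof.
by move=> T; apply=> //; [exact: tail_op_cstar | exact: tail_word_closed_tail].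
Qed.

Lemma expectation_bounded a : bounded_op (F (pi a)).
Proof.
have [tb _ _ _ _] := tail_op_cstar.
by apply: tb; apply: expectation_Q_tail; exact: pi_Q.
Qed.

(** The set of [a] with [S (F (pi a))] is a closed subspace, but not visibly a
    subalgebra, so that one argues on words. *)
Lemma expectation_tail_cstar a : D (F (pi a)).
Proof.
move=> S [Sb S1 Slin _ Sclos] _ Sword; move: a.
apply: (words_total hU) => [c a b Sa Sb'|w|a ha].
- by rewrite expectation_comb; exact: Slin.
- (* tail words end with a bare letter, here [lam 0 1 = 1] *)
  pose one : S := SigSub (mem_set S1).
  have := Sword [seq (p, one) | p <- w] 0%N 1.
  suff -> : tail_word lam pi [seq (p.1, val p.2) | p <- [seq (p, one) | p <- w]] 0 1
      = pi (word lam w) by [].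
  have [_ pi1 _ pim _] := pi_rep.
  elim: w => [|[i a] w IH]; first by rewrite /word big_nil /tail_word /= rmorph1.
  by rewrite /= -/(tail_word _ _ _ _ _) IH word_cons pim.
- apply: Sclos => [|e e0]; first exact: expectation_bounded.
  have er : e = (complex.Re e)%:C by rewrite RRe_real // gtr0_real.
  have [|b Sb' hb] := ha (complex.Re e); first by rewrite -ltcR -er.
  exists (F (pi b)) => // x; rewrite expectation_sub.
  apply: le_trans (expectation_norm _ _) _; rewrite ler_wpM2r //.
  by rewrite er lecR ltW.
Qed.

Section SymmetricVectorState.
Variables (xi : H) (psi : U -> R[i]).
Hypothesis xi_cyclic : closure (range (fun a => pi a xi)) = setT.
Hypothesis psi_sym : symmetric_states lam psi.

Lemma orbit_linear : linear (fun a => pi a xi).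
Proof. by have [_ _ pil _ _] := pi_rep => c a b; rewrite pil. Qed.

Lemma rep_vector_functional_bound (p : U -> H -> H) (eta zeta : H) (a : U) :
  star_representation p ->
  `|inner (p a eta) zeta| <= `|eta| * `|zeta| * (cnorm a)%:C.
Proof.
move=> prep; apply: le_trans (inner_CauchySchwarz _ _) _.
by rewrite [leRHS]mulrC mulrA ler_wpM2r // star_representation_norm.
Qed.

(** A functional [psi] is recovered from the expectation as soon as it is
    symmetric and given by a vector: [alpha] acts on words by shifting them, so
    that the sequence converging to [F (pi a)] is constant against these vectors. *)
Lemma expectation_symmetric_functional eta :
  (forall a, psi a = inner (pi a xi) eta) ->
  forall a, inner (F (pi a) xi) eta = psi a.
Proof.
move=> psiE a.
have shift_inv n b : inner (shift_rep n b xi) eta = psi b.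
  rewrite psiE; move: b.
  apply: (eq_on_words hU (k := `|xi| * `|eta|) (l := `|xi| * `|eta|)).
  - by rewrite mulr_ge0.
  - by rewrite mulr_ge0.
  - by have [_ _ sl _ _] := shift_repP n => c x y; rewrite sl inner_linear.
  - by have [_ _ sl _ _] := pi_rep => c x y; rewrite sl inner_linear.
  - by move=> x; apply: rep_vector_functional_bound; exact: shift_repP.
  - by move=> x; apply: rep_vector_functional_bound.
  - by move=> w; rewrite shift_rep_word -!psiE -(symmetric_shift psi_sym).
rewrite psiE; apply: wot_cvg_eq (@expectation_cvg a) (@wot_cvg_const _ _ (pi a)) _.
by exists 0%N => n _; rewrite shift_inv psiE.
Qed.

(** Seen from a pair of vectors [pi u xi] and [pi v xi], the shifted word is far
    away from [u] and [v], so that its letters may be permuted alone. *)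
Lemma expectation_word_reindex w s :
  (forall a, psi a = inner (pi a xi) xi) -> bijective s ->
  F (pi (word lam w)) = F (pi (word lam (reindex s w))).
Proof.
move=> psiE sbij.
have [_ _ _ pim pia] := pi_rep.
apply: (bounded_op_dense_eq xi_cyclic); try exact: expectation_bounded.
pose G w' u v := inner (F (pi (word lam w')) (pi u xi)) (pi v xi).
have words u v : G w (word lam u) (word lam v) =
    G (reindex s w) (word lam u) (word lam v).
  rewrite /G; apply: (wot_cvg_eq (@expectation_cvg (word lam w))
    (@expectation_cvg (word lam (reindex s w)))).
  have [N hN] := symmetric_shifted_reindex psi_sym (star_word v) u w sbij.
  exists N => n /hN.
  rewrite !shift_rep_word !psiE !word_cat -!(star_wordE hU) !pim /=.
  by rewrite !pia starK.
have left_words u v : G w u (word lam v) = G (reindex s w) u (word lam v).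
  have lin w' : scalar (fun u => G w' u (word lam v)).
    by move=> c x y; rewrite /G orbit_linear (expectation_bounded _).1 inner_linear.
  have bd w' x : `|G w' x (word lam v)| <=
      (cnorm (word lam w'))%:C * `|xi| * `|pi (word lam v) xi| * (cnorm x)%:C.
    apply: le_trans (inner_CauchySchwarz _ _) _.
    rewrite [leRHS]mulrAC ler_wpM2r //.
    apply: le_trans (expectation_norm _ _) _.
    rewrite -mulrA ler_wpM2l ?lecR ?cnorm_ge0 // mulrC.
    exact: star_representation_norm.
  apply: (eq_on_words hU _ _ (lin w) (lin (reindex s w)) (bd w) (bd (reindex s w)));
    by rewrite ?mulr_ge0 ?lecR ?cnorm_ge0.
move=> a; apply: (dense_inner_ext xi_cyclic).
have lin z : scalar (fun b => inner (pi b xi) z).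
  by move=> c x y; rewrite orbit_linear inner_linear.
apply: (eq_on_words hU _ _ (lin _) (lin _)
  (fun b => rep_vector_functional_bound xi _ b pi_rep)
  (fun b => rep_vector_functional_bound xi _ b pi_rep)) => [||v];
  rewrite ?mulr_ge0 //.
by rewrite innerC [RHS]innerC; congr Num.conj; exact: left_words.
Qed.

End SymmetricVectorState.

End TailExpectation.

(** * States of operator algebras *)

Section OperatorStates.
Variables (R : realType) (H : hilbertType R) (S : set (H -> H)).
Hypothesis S_cstar : op_cstar_algebra S.
Variable f : S -> R[i].
Hypothesis f_state : op_state f.

(** Positivity of [f ((y + s) ^ 2)] for real [s], at [s = 1] and then at
    [s = - f y]. *)
Lemma op_state_square (y z : S) :
  adjoint_op (val y) (val y) -> val z = val y \o val y ->
  f y \is Num.real /\ f y ^+ 2 <= f z.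
Proof.
move=> yadj zE; have [flin fpos f1] := f_state.
have [Sb S1 Slin [Smul _] _] := S_cstar.
have [ylin _] := Sb _ (set_mem (valP y)).
pose one : S := SigSub (mem_set S1).
have pos (s : R[i]) : s \is Num.real -> 0 <= f z + 2 * s * f y + s ^+ 2.
  move=> /conj_Creal sr.
  have Sw := Slin s _ _ S1 (set_mem (valP y)).
  pose w : S := SigSub (mem_set Sw).
  have Syz := Slin s _ _ (set_mem (valP y)) (set_mem (valP z)).
  pose yz : S := SigSub (mem_set Syz).
  pose v : S := SigSub (mem_set (Slin s _ _ Sw Syz)).
  have -> : f z + 2 * s * f y + s ^+ 2 = f v.
    rewrite (flin s w yz v) // (flin s one y w) // (flin s y z yz) //.
    by rewrite (f1 one erefl); ring.
  apply: (fpos w w).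
    move=> h k /=; rewrite inner_linear inner_linear_r sr yadj; ring.
  by apply/funext => h /=; rewrite zE /= ylin.
have z0 : 0 <= f z by apply: fpos yadj zE.
have yr : f y \is Num.real.
  have := pos 1 (rpred1 _); rewrite mulr1 expr1n => h.
  have -> : f y = (f z + 2 * f y + 1 - f z - 1) / 2 by field.
  by rewrite rpredM ?rpredV ?rpredB ?realn // ger0_real.
split=> //; have := pos (- f y); rewrite rpredN => /(_ yr).
have -> : f z + 2 * - f y * f y + (- f y) ^+ 2 = f z - f y ^+ 2 by ring.
by rewrite subr_ge0.
Qed.

(** A positive operator [P <= k] need not be written as a square in [S]: with
    [x = 1 - P / k], the numbers [r n = f (x ^ (2 ^ n))] satisfy
    [r n.+1 >= r n ^ 2] and stay bounded because the norms of the powers of [x]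
    do and [f] is dominated by a vector functional.  Hence [f x <= 1], that is
    [0 <= f P]. *)
Lemma dominated_op_state_ge0 (c k : R) (xi : H) (P : S) :
  0 <= c ->
  (forall T1 T2 T : S, adjoint_op (val T1) (val T2) -> val T = val T2 \o val T1 ->
     f T <= c%:C * `|val T1 xi| ^+ 2) ->
  0 < k -> (forall h, 0 <= inner (val P h) h <= k%:C * `|h| ^+ 2) ->
  0 <= f P.
Proof.
move=> c0 fdom k0 hP; have [flin fpos f1] := f_state.
have [Sb S1 Slin [Smul _] _] := S_cstar.
have PS := set_mem (valP P); have bP := Sb _ PS.
have k0' : 0 < k%:C by rewrite ltcR.
have kr : Num.conj (k%:C^-1) = k%:C^-1.
  by apply: conjc_ge0; rewrite invr_ge0 ltW.
pose one : S := SigSub (mem_set S1).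
pose x : S := SigSub (mem_set (Slin (- k%:C^-1) _ _ PS S1)).
have xE h : val x h = h - k%:C^-1 *: val P h by rewrite /= scaleNr addrC.
have [xlin _] := Sb _ (set_mem (valP x)).
have xpos h : 0 <= inner (val x h) h <= `|h| ^+ 2.
  have /andP[P0 P1] := hP h.
  rewrite xE innerBl innerZl inner_norm subr_ge0 ler_pdivrMl // P1 /=.
  by rewrite gerBl mulr_ge0 // invr_ge0 ltW.
have xform : positive_form (fun h l => inner (val x h) l).
  split=> [d u v z|d u v z|h]; first by rewrite xlin inner_linear.
    by rewrite inner_linear_r.
  by have /andP[] := xpos h.
have xadj : adjoint_op (val x) (val x).
  by move=> h l; rewrite (positive_form_hermitian xform) -innerC.
have xcontr h : `|val x h| <= `|h|.
  have [->|xh0] := eqVneq (val x h) 0; first by rewrite normr0.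
  have xh : 0 < `|val x h| ^+ 2 by rewrite exprn_gt0 // normr_gt0.
  rewrite -ler_sqr ?nnegrE // -(ler_pM2r xh).
  have := positive_form_CauchySchwarz xform h (val x h).
  rewrite /= inner_norm normrX normr_id -expr2 => /le_trans; apply.
  have /andP[p1 p2] := xpos h; have /andP[p3 p4] := xpos (val x h).
  exact: ler_pM.
pose sq (y : S) : S :=
  SigSub (mem_set (Smul _ _ (set_mem (valP y)) (set_mem (valP y)))).
pose Y n := iter n sq x.
have Yadj n : adjoint_op (val (Y n)) (val (Y n)).
  by elim: n => [//|n IH] h l /=; rewrite !IH.
have Ycontr n h : `|val (Y n) h| <= `|h|.
  by elim: n h => [//|n IH] h /=; apply: le_trans (IH _) (IH _).
pose r n := complex.Re (f (Y n)).
have rE n : f (Y n) = (r n)%:C.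
  by rewrite RRe_real //; have [] := op_state_square (Yadj n) (erefl (val (Y n.+1))).
have rsq n : r n ^+ 2 <= r n.+1.
  rewrite -lecR rmorphXn /= -!rE.
  by have [] := op_state_square (Yadj n) (erefl (val (Y n.+1))).
have rbd : exists C, forall n, r n.+1 <= C.
  exists (c * complex.Re `|xi| ^+ 2) => n; rewrite -lecR rmorphM rmorphXn /= -rE.
  rewrite RRe_real ?ger0_real //.
  apply: le_trans (fdom _ _ _ (Yadj n) (erefl (val (Y n.+1)))) _.
  by rewrite ler_wpM2l ?lecR // ler_sqr ?nnegrE.
have r0 : r 0%N <= 1.
  rewrite leNgt; apply/negP => r1; set d := r 0%N - 1.
  have d0 : 0 < d by rewrite subr_gt0.
  have grow n : 1 + n.+1%:R * d <= r n.
    elim: n => [|n IH]; first by rewrite mul1r /d addrC subrK.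
    apply: le_trans (rsq n).
    have n0 : 0 <= n%:R * d by rewrite mulr_ge0 // ltW.
    have := IH; rewrite -[n.+1%:R]natr1 -[n.+2%:R]natr1 -[n.+1%:R]natr1; nra.
  have [C hC] := rbd.
  have [n hn] : exists n, C < n%:R * d.
    exists (Num.bound `|C / d|); rewrite -ltr_pdivrMr //.
    exact: le_lt_trans (ler_norm _) (archi_boundP (normr_ge0 _)).
  have := hC n; have := grow n.+1.
  rewrite -[n.+2%:R]natr1 -[n.+1%:R]natr1; nra.
have fxE : f x = - k%:C^-1 * f P + 1.
  by rewrite (flin (- k%:C^-1) P one x) // (f1 one erefl).
have -> : f P = k%:C * (1 - f x).
  by rewrite fxE; field; rewrite gt_eqF.
apply: mulr_ge0; first exact: ltW.
rewrite subr_ge0 -[x]/(Y 0%N) rE -(rmorph1 (real_complex R)).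
by rewrite lecR.
Qed.

End OperatorStates.

(** * Symmetric states and states of the tail C*-algebra *)

Section Correspondence.
Variables (R : realType) (A U : cstarAlgType R) (H : hilbertType R).
Variables (lam : nat -> {lrmorphism A -> U}) (pi : U -> H -> H) (xi : H).
Variables (alpha F : (H -> H) -> (H -> H)) (psi : U -> R[i]).
Hypothesis hU : universal_free_product lam.
Hypothesis psi_sym : symmetric_states lam psi.
Hypothesis hpi : gns pi psi xi.
Hypothesis halpha : tail_shift lam pi alpha.
Hypothesis hF : tail_expectation lam pi alpha F.

Local Notation D := (tail_cstar_algebra lam pi F).
Let rho : D -> R[i] := vector_functional xi (S:=D).

Lemma gns_representation : star_representation pi.
Proof. by case: hpi => -[pib pi1] pil [pim pia] _ _. Qed.

Let pi_rep := gns_representation.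
Let cyclic : closure (range (fun a => pi a xi)) = setT.
Proof. by case: hpi. Qed.
Let psiE a : psi a = inner (pi a xi) xi.
Proof. by case: hpi. Qed.

Lemma psi_sq a : psi (star a * a) = `|pi a xi| ^+ 2.
Proof.
have [_ _ _ pim pia] := pi_rep.
by rewrite psiE pim /= pia starK inner_norm.
Qed.

(** The Radon-Nikodym operator of [g]: it represents the form [g (star b * a)],
    which is bounded on the orbit of [xi] because [g] is dominated by [psi]. *)
Lemma dominated_state_operator (g : U -> R[i]) (c : R) :
  state g -> 0 <= c -> (forall x, g (star x * x) <= c%:C * psi (star x * x)) ->
  exists T, [/\ bounded_op T, adjoint_op T T, (forall h, 0 <= inner (T h) h),
    (forall a, T \o pi a = pi a \o T) & forall a, g a = inner (pi a xi) (T xi)].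
Proof.
move=> [glin gpos g1] c0 gdom; have [_ pi1 _ pim pia] := pi_rep.
have gform := positive_functional_form glin gpos.
have [|T [bT adjT posT gT]] :=
    bounded_form_operator (@orbit_linear _ _ _ _ pi_rep xi) cyclic gform c0.
  have c0' : 0 <= c%:C by rewrite lecR.
  move=> a b; rewrite -ler_sqr ?nnegrE; last 2 first.
  - by [].
  - by rewrite mulr_ge0 // mulr_ge0.
  apply: le_trans (positive_form_CauchySchwarz gform a b) _ => /=.
  rewrite !exprMn expr2 mulrACA -!psi_sq.
  by apply: ler_pM.
have gE a : g a = inner (pi a xi) (T xi).
  by have := gT a 1; rewrite star1 mul1r pi1.
exists T; split=> // a; apply: (bounded_op_dense_eq cyclic).
- by apply: bounded_op_comp => //; case: pi_rep.
- by apply: bounded_op_comp => //; case: pi_rep.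
move=> b /=; apply: (dense_inner_ext cyclic) => u.
rewrite -[pi a (pi b xi)]/((pi a \o pi b) xi) -pim -gT starM.
by rewrite -[a in RHS]starK -pia -[pi _ (pi u xi)]/((pi _ \o pi u) xi) -pim -gT mulrA.
Qed.

(** The commutant of [T] is a von Neumann algebra containing the range of [pi],
    hence contains the tail algebra. *)
Lemma tail_cstar_commute T d : bounded_op T -> adjoint_op T T ->
  (forall a, T \o pi a = pi a \o T) -> D d -> d \o T = T \o d.
Proof.
move=> bT adjT Tpi Dd.
have /(_ 0%N I)/(_ (commutant [set T])) [||_] :=
    tail_cstar_sub_tail pi_rep hF Dd.
- exact: commutant_selfadjoint_von_neumann.
- move=> _ [i [a [_ ->]]]; split=> [|_ -> //]; by case: pi_rep.
- by apply.
Qed.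

Definition vector_pair_functional (eta : H) (d : D) : R[i] := inner (val d xi) eta.

Lemma dominated_functional_op_state T : bounded_op T -> adjoint_op T T ->
  (forall h, 0 <= inner (T h) h) -> (forall a, T \o pi a = pi a \o T) ->
  inner xi (T xi) = 1 -> op_state (vector_pair_functional (T xi)).
Proof.
move=> bT adjT posT Tpi T1; split.
- by move=> c d1 d2 d dE; rewrite /vector_pair_functional dE inner_linear.
- move=> d1 d2 d adj dE; rewrite /vector_pair_functional dE /=.
  rewrite innerC -adj.
  have /(congr1 (@^~ xi))/= -> := tail_cstar_commute bT adjT Tpi (set_mem (valP d1)).
  by rewrite conjc_ge0.
- by move=> d dE; rewrite /vector_pair_functional dE.
Qed.

Lemma expectationE a : exists2 d : D, val d = F (pi a) & psi a = rho d.
Proof.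
exists (SigSub (mem_set (expectation_tail_cstar hU pi_rep halpha hF a))) => //.
rewrite /rho /vector_functional /=.
by rewrite (expectation_symmetric_functional hU pi_rep halpha hF psi_sym).
Qed.

(** Write [psi = t g + (1 - t) h].  Both [g] and [h] are given by vectors
    [eta = T xi] with [T] positive in the commutant of [pi], so that these vectors
    also define states of [D], of which [rho] is the same convex combination.
    Purity identifies these states with [rho], and by symmetry [g] and [h] are
    recovered from them through [F]. *)
Lemma extreme_of_pure : pure_state rho -> extreme_point (symmetric_states lam) psi.
Proof.
move=> [_ rho_extreme]; split=> // g h t gS hS /andP[t0 t1] psi_gh.
have op_of k s : symmetric_states lam k -> 0 < s ->
    (forall x, s%:C * k (star x * x) <= psi (star x * x)) ->
    exists eta, op_state (vector_pair_functional eta) /\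
      forall a, k a = inner (pi a xi) eta.
  move=> kS s0 kdom.
  have [||T [bT adjT posT Tpi kE]] := @dominated_state_operator k s^-1 kS.1.
  - by rewrite invr_ge0 ltW.
  - by move=> x; rewrite rmorphV ?unitfE ?gt_eqF // ler_pdivlMl ?ltcR.
  exists (T xi); split=> //; apply: dominated_functional_op_state => //.
  have [_ _ k1] := kS.1; rewrite -k1 kE.
  by have [_ -> _ _ _] := pi_rep.
have s0 : 0 < 1 - t by rewrite subr_gt0.
have [_ gpos _] := gS.1; have [_ hpos _] := hS.1.
have [|eta [etaS gE]] := op_of g t gS t0.
  by move=> x; rewrite psi_gh lerDl mulr_ge0 // lecR ltW.
have [|zeta [zetaS hE]] := op_of h _ hS s0.
  by move=> x; rewrite psi_gh lerDr mulr_ge0 // lecR ltW.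
have comb : t%:C *: eta + (1 - t)%:C *: zeta = xi.
  apply: (dense_inner_ext cyclic) => a.
  by rewrite innerDr !innerZr !conj_realC -gE -hE -psi_gh psiE.
have [eg eh] : vector_pair_functional eta = rho /\ vector_pair_functional zeta = rho.
  apply: (rho_extreme _ _ t) => //; first by rewrite t0.
  move=> d; rewrite /rho /vector_functional -{2}comb innerDr !innerZr.
  by rewrite !conj_realC.
have eq_psi k eta' : symmetric_states lam k ->
    (forall a, k a = inner (pi a xi) eta') -> vector_pair_functional eta' = rho ->
    k = psi.
  move=> kS kE keq; apply/funext => a; have [d dE ->] := expectationE a.
  rewrite -keq /vector_pair_functional dE.
  by rewrite (expectation_symmetric_functional hU pi_rep halpha hF kS kE).
by split; [exact: eq_psi gS gE eg | exact: eq_psi hS hE eh].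
Qed.

Let dF a : D := SigSub (mem_set (expectation_tail_cstar hU pi_rep halpha hF a)).

(** Domination of [g] by [rho] serves for the positivity of [g o F o pi]: it allows
    one to apply [g] to the positive element [F (pi (star a * a))] of [D]. *)
Lemma symmetric_of_op_state (g : D -> R[i]) (c : R) : op_state g -> 0 <= c ->
  (forall T1 T2 T : D, adjoint_op (val T1) (val T2) -> val T = val T2 \o val T1 ->
     g T <= c%:C * rho T) ->
  symmetric_states lam (fun a => g (dF a)).
Proof.
move=> gS c0 gdom; have [glin _ g1] := gS.
split; last first.
  move=> w s sbij; congr g; apply: val_inj => /=.
  rewrite -/(word lam w).
  rewrite (expectation_word_reindex hU pi_rep halpha hF cyclic psi_sym w psiE sbij).
  by rewrite /word big_map.
split.
- move=> d a b; apply: glin => /=.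
  exact: (expectation_comb pi_rep halpha hF).
- move=> a.
  apply: (@dominated_op_state_ge0 R H D _ g gS c (cnorm (star a * a) + 1) xi) => //.
  + exact: (tail_cstar_op_cstar pi_rep hF).
  + move=> T1 T2 T adj TE; apply: le_trans (gdom _ _ _ adj TE) _.
    rewrite /rho /vector_functional TE /= innerC -adj inner_norm.
    by rewrite conjc_ge0 ?exprn_ge0.
  + by rewrite ltr_wpDl ?cnorm_ge0.
  + move=> h; rewrite (expectation_ge0 pi_rep halpha hF) /=.
    rewrite -[leLHS]ger0_norm ?(expectation_ge0 pi_rep halpha hF) //.
    apply: le_trans (inner_CauchySchwarz _ _) _; rewrite expr2 mulrA ler_wpM2r //.
    apply: le_trans (expectation_norm pi_rep halpha hF _ _) _.
    by rewrite ler_wpM2r // lecR lerDl.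
- apply: g1 => /=; have [_ pi1 _ _ _] := pi_rep.
  rewrite pi1 (expectation_tail halpha hF) //.
  by have [_ t1 _ _ _] := @tail_op_cstar _ _ _ _ lam _ pi_rep.
Qed.

(** Since [D] lies in the range of [pi] and [F] fixes it, every element of [D] is
    of the form [F (pi a)]; a state of [D] is thus determined by the symmetric
    state that it induces. *)
Lemma pure_of_extreme : extreme_point (symmetric_states lam) psi ->
  D `<=` range pi -> pure_state rho.
Proof.
move=> [_ psi_extreme] Dpi.
have [_ pi1 _ _ _] := pi_rep.
have rhopos (T1 T2 T : D) : adjoint_op (val T1) (val T2) ->
    val T = val T2 \o val T1 -> 0 <= rho T.
  move=> adj TE; rewrite /rho /vector_functional TE /= innerC -adj inner_norm.
  by rewrite conjc_ge0 exprn_ge0.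
have rhoS : op_state rho.
  split=> // [c T1 T2 T TE|T TE]; rewrite /rho /vector_functional TE ?inner_linear //.
  by have [[_ _ <-] _] := psi_sym; rewrite psiE pi1.
split=> // g h t gS hS /andP[t0 t1] rho_gh.
have s0 : 0 < 1 - t by rewrite subr_gt0.
have [_ gpos _] := gS; have [_ hpos _] := hS.
have gsym : symmetric_states lam (fun a => g (dF a)).
  apply: (@symmetric_of_op_state g t^-1) => //; first by rewrite invr_ge0 ltW.
  move=> T1 T2 T adj TE; rewrite rho_gh rmorphV ?unitfE ?gt_eqF //.
  rewrite ler_pdivlMl ?ltcR // lerDl mulr_ge0 ?lecR ?(ltW s0) //.
  exact: hpos adj TE.
have hsym : symmetric_states lam (fun a => h (dF a)).
  apply: (@symmetric_of_op_state h (1 - t)^-1) => //; first by rewrite invr_ge0 ltW.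
  move=> T1 T2 T adj TE; rewrite rho_gh rmorphV ?unitfE ?gt_eqF //.
  rewrite ler_pdivlMl ?ltcR // lerDr mulr_ge0 ?lecR ?(ltW t0) //.
  exact: gpos adj TE.
have psi_dF a : psi a = rho (dF a).
  by have [d dE ->] := expectationE a; congr rho; apply: val_inj.
have [||eg eh] := psi_extreme _ _ t gsym hsym.
- by rewrite t0.
- by move=> a; rewrite psi_dF rho_gh.
have dF_id (d : D) : exists a, dF a = d.
  have [a _ ad] := Dpi _ (set_mem (valP d)); exists a; apply: val_inj => /=.
  rewrite ad (expectation_tail halpha hF) //.
  exact: (tail_cstar_sub_tail pi_rep hF (set_mem (valP d))).
split; apply/funext => d; have [a <-] := dF_id d; rewrite -psi_dF.
  by rewrite -eg.
by rewrite -eh.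
Qed.

End Correspondence.

Theorem proposition5p4p3 (R : realType) (A U : cstarAlgType R)
    (lam : nat -> {lrmorphism A -> U})
    (hU : universal_free_product lam)
    (psi : U -> R[i]) (hpsi : symmetric_states lam psi)
    (H : hilbertType R) (pi : U -> H -> H) (xi : H) (hpi : gns pi psi xi)
    (alpha : (H -> H) -> (H -> H)) (halpha : tail_shift lam pi alpha)
    (F : (H -> H) -> (H -> H)) (hF : tail_expectation lam pi alpha F) :
  let D := tail_cstar_algebra lam pi F in
  let rho : D -> R[i] := vector_functional xi (S:=D) in
  [/\ (forall a : U, exists2 d : D, val d = F (pi a) & psi a = rho d),
      (pure_state rho -> extreme_point (symmetric_states lam) psi) &
      (extreme_point (symmetric_states lam) psi -> D `<=` range pi ->
         pure_state rho)].
Proof.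
move=> D rho; split.
- exact: (expectationE hU hpsi hpi halpha hF).
- exact: (extreme_of_pure hU hpsi hpi halpha hF).
- exact: (pure_of_extreme hU hpsi hpi halpha hF).
Qed.
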